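(* Let $T$ be a tetrahedron, $\mathbf r_2=(r_2^{\mathtt v},r_2^e,r_2^f)$ an integer vector and $k\ge\max\{2r_2^{\mathtt v}+1,1\}$ an integer. Assume that one of the following holds: (i) $r_2^f\ge0$, $r_2^e\ge2r_2^f+1$, $r_2^{\mathtt v}\ge2r_2^e$; (ii) $r_2^f=-1$, $r_2^e\ge1$, $r_2^{\mathtt v}\ge2r_2^e$; (iii) $r_2^f=-1$, $r_2^e\in\{0,-1\}$, $r_2^{\mathtt v}\ge2r_2^e+1$. Let $\mathbf r_3=\mathbf r_2\ominus1$ and assume $\dim\mathbb B_{k-1}(T;\mathbf r_3)\ge1$. Then $$\operatorname{div}\mathbb B_k^{\mathrm{div}}(T;\mathbf r_2)=\mathbb B_{k-1}(T;\mathbf r_3)/\mathbb R .$$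
   Context: $r\ominus1:=\max\{r-1,-1\}$, applied componentwise to vectors. For a tetrahedron $T$ with vertices indexed by $0,\dots,3$ and barycentric coordinates $\lambda_0,\dots,\lambda_3$, let $\mathbb T_k^3=\{\alpha\in\mathbb N^{4}:|\alpha|=k\}$ and $\lambda^\alpha=\prod_i\lambda_i^{\alpha_i}$. Identifying a subsimplex $g$ of $T$ with its set of vertex indices, put $\operatorname{dist}(\alpha,g)=\sum_{i\notin g}\alpha_i$. For $\mathbf r=(r^{\mathtt v},r^e,r^f)$, $$\mathbb B_k(T;\mathbf r)=\operatorname{span}\{\lambda^\alpha:\alpha\in\mathbb T_k^3,\ \operatorname{dist}(\alpha,\mathtt v)>r^{\mathtt v},\ \operatorname{dist}(\alpha,e)>r^e,\ \operatorname{dist}(\alpha,f)>r^f\ \text{for all vertices }\mathtt v,\text{ edges }e,\text{ faces }f\text{ of }T\},$$ $$\mathbb B^{\mathrm{div}}_k(T;\mathbf r)=\{v\in\mathbb B_k(T;\mathbf r)^3:\ v\cdot n=0\text{ on }\partial T\},$$ where $n$ is the unit outward normal, and $\mathbb B_{k}(T;\mathbf r)/\mathbb R:=\mathbb B_{k}(T;\mathbf r)\cap L_0^2(T)$, with $L_0^2(T)$ the functions in $L^2(T)$ of zero mean. *)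

(* Defs.v *)
From HB Require Import structures.
From mathcomp Require Import all_boot all_order all_algebra.
From mathcomp Require Import all_classical all_reals all_analysis.

Set Implicit Arguments.
Unset Strict Implicit.
Unset Printing Implicit Defensive.

Import Order.TTheory GRing.Theory Num.Theory.
Import numFieldNormedType.Exports.

Local Open Scope classical_set_scope.
Local Open Scope ring_scope.

Section LinearAlgebra.
Variables (R : realType) (V : lmodType R).

Definition lin_span (A : set V) : set V :=
  [set u | exists n (c : 'I_n -> R) (v : 'I_n -> V),
     (forall i, A (v i)) /\ u = \sum_(i < n) c i *: v i].

Definition lin_indep n (b : 'I_n -> V) : Prop :=
  forall c : 'I_n -> R, \sum_(i < n) c i *: b i = 0 -> forall i, c i = 0.

Definition has_dim (S : set V) (d : nat) : Prop :=
  exists b : 'I_d -> V, lin_indep b /\ S = lin_span (range b).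

(* Equals 0 when S is not a finite-dimensional subspace; the spaces B_k below
   always are. *)
Definition lin_dim (S : set V) : nat := xget 0%N [set d | has_dim S d].

End LinearAlgebra.

Section Geometry.
Variable R : realType.

Definition affinely_independent m n (p : 'I_m -> 'rV[R]_n) : Prop :=
  forall c : 'I_m -> R, \sum_i c i = 0 -> \sum_i c i *: p i = 0 ->
  forall i, c i = 0.

Record tetrahedron := Tetrahedron {
  vertex : 'I_4 -> 'rV[R]_3;
  vertex_indep : affinely_independent vertex }.

Variable T : tetrahedron.

Definition tetra : set 'rV[R]_3 :=
  [set x | exists c : 'I_4 -> R,
     [/\ forall i, 0 <= c i, \sum_i c i = 1 & x = \sum_i c i *: vertex T i]].

(* The closed face opposite to vertex i; the boundary of T is the union of the
   four faces. *)
Definition face (i : 'I_4) : set 'rV[R]_3 :=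
  [set x | exists c : 'I_4 -> R,
     [/\ forall j, 0 <= c j, c i = 0, \sum_j c j = 1
       & x = \sum_j c j *: vertex T j]].

Definition dot (u v : 'rV[R]_3) : R := \sum_j u 0 j * v 0 j.

(* n is the outward unit normal of T on the face opposite to vertex i (the norm
   of the library on row vectors is the sup norm, hence the use of dot). *)
Definition outward_unit_normal (i : 'I_4) (n : 'rV[R]_3) : Prop :=
  [/\ dot n n = 1,
      forall j l, j != i -> l != i -> dot n (vertex T j - vertex T l) = 0
    & forall j, j != i -> dot n (vertex T i - vertex T j) < 0].

(* Row i is (vertex i, 1). The barycentric coordinates of x form the row vector
   l such that l *m vertex_mx = (x, 1). *)
Definition vertex_mx : 'M[R]_(3 + 1) :=
  \matrix_(i < 3 + 1) row_mx (vertex T i) 1.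

Definition bary (i : 'I_4) (x : 'rV[R]_3) : R :=
  (row_mx x 1 *m invmx vertex_mx) 0 i.

Lemma mul_vertex_mx (l : 'rV[R]_(3 + 1)) :
  l *m vertex_mx =
  row_mx (\sum_i l 0 i *: vertex T i) ((\sum_i l 0 i)%:M).
Proof.
rewrite mulmx_sum_row (eq_bigr (fun i : 'I_(3 + 1) =>
  row_mx (l 0 i *: vertex T i) ((l 0 i)%:M : 'M[R]_1))); last first.
  by move=> i _; rewrite rowK scale_row_mx scale_scalar_mx mulr1.
elim/big_ind3 : _ => [|x1 x2 x3 y1 y2 y3 -> ->|//].
  by rewrite raddf0 row_mx0.
by rewrite add_row_mx raddfD.
Qed.

Lemma vertex_mx_unit : vertex_mx \in unitmx.
Proof.
rewrite -row_free_unit -kermx_eq0; apply/rowV0P => l /sub_kermxP.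
rewrite mul_vertex_mx -[RHS]row_mx0 => /eq_row_mx[l1 /matrixP/(_ 0 0)].
rewrite !mxE eqxx mulr1n => l0; apply/rowP => i; rewrite mxE.
exact: (vertex_indep l0 l1).
Qed.

Lemma bary_spec x :
  \sum_i bary i x *: vertex T i = x /\ \sum_i bary i x = 1.
Proof.
have := mulmxKV vertex_mx_unit (row_mx x 1).
rewrite mul_vertex_mx => /eq_row_mx[-> /matrixP/(_ 0 0)].
by rewrite !mxE eqxx mulr1n.
Qed.

End Geometry.

(* Smoothness at vertices, edges and faces. *)
Record smoothness := Smoothness { sm_v : int; sm_e : int; sm_f : int }.

Definition ominus1 (r : int) : int := Num.max (r - 1) (-1).

Definition sm_ominus1 (r : smoothness) : smoothness :=
  Smoothness (ominus1 (sm_v r)) (ominus1 (sm_e r)) (ominus1 (sm_f r)).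

Definition multi_index := {ffun 'I_4 -> nat}.

Definition mi_size (a : multi_index) : nat := (\sum_i a i)%N.

Definition mi_dist (a : multi_index) (g : {set 'I_4}) : nat :=
  (\sum_(i | i \notin g) a i)%N.

(* Subsimplices are sets of vertex indices: vertices, edges and faces are those
   of cardinality 1, 2 and 3. *)
Definition admissible (k : int) (r : smoothness) (a : multi_index) : Prop :=
  [/\ (mi_size a)%:Z = k,
      forall v : {set 'I_4}, #|v| = 1%N -> sm_v r < (mi_dist a v)%:Z,
      forall e : {set 'I_4}, #|e| = 2%N -> sm_e r < (mi_dist a e)%:Z
    & forall f : {set 'I_4}, #|f| = 3%N -> sm_f r < (mi_dist a f)%:Z].

Section Lebesgue3.
Variable R : realType.

Definition lebesgue2 := (@lebesgue_measure R \x @lebesgue_measure R)%E.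

HB.instance Definition _ := Measure.on lebesgue2.

Lemma lebesgue2_sigma_finite : sigma_finite setT lebesgue2.
Proof.
by case: (lebesgue_integral_fubini.measure_function_Measure_isSigmaFinite__to__measure_function_isSigmaFinite
            (@lebesgue_measure R) (@lebesgue_measure R)).
Qed.

(* Canonical inference on a bare product of measures looks for finite factors,
   so the sigma-finite instance is attached to a named constant. *)
HB.instance Definition _ :=
  Measure_isSigmaFinite.Build _ _ _ lebesgue2 lebesgue2_sigma_finite.

Definition lebesgue3 := (lebesgue2 \x @lebesgue_measure R)%E.

(* There is no measure on row vectors: they are integrated through this
   coordinate bijection. *)
Definition point3 (t : R * R * R) : 'rV[R]_3 :=
  \row_j [tuple t.1.1; t.1.2; t.2]`_j.

End Lebesgue3.

Section BubbleSpaces.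
Variables (R : realType) (T : tetrahedron R).

(* Polynomials on T are represented by the polynomial functions on the whole
   space; restriction to T is injective on these. *)
Definition bary_monomial (a : multi_index) : 'rV[R]_3 -> R :=
  fun x => \prod_i bary T i x ^+ a i.

Definition bubble (k : int) (r : smoothness) : set ('rV[R]_3 -> R) :=
  lin_span [set bary_monomial a | a in admissible k r].

Definition bubble_div (k : int) (r : smoothness) :
    set ('rV[R]_3 -> 'rV[R]_3) :=
  [set v : 'rV[R]_3 -> 'rV[R]_3 | (forall j, bubble k r (fun x => v x 0 j)) /\
     forall i x n, face T i x -> outward_unit_normal T i n -> dot (v x) n = 0].

Definition divergence (v : 'rV[R]_3 -> 'rV[R]_3) : 'rV[R]_3 -> R :=
  fun x => \sum_j 'D_(delta_mx 0 j) (fun y => v y 0 j) x.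

(* Membership in L^2(T) is that of the extension of q by zero outside T. *)
Definition L2_0 : set ('rV[R]_3 -> R) :=
  [set q : 'rV[R]_3 -> R |
     (q \o @point3 R) \_ (@point3 R @^-1` tetra T) \in Lfun (@lebesgue3 R) 2%:E /\
     \int[@lebesgue3 R]_(t in @point3 R @^-1` tetra T) q (point3 t) = 0].

Definition bubble_mean0 (k : int) (r : smoothness) : set ('rV[R]_3 -> R) :=
  bubble k r `&` L2_0.

End BubbleSpaces.

(* Main.v *)
Require Import Defs.
From HB Require Import structures.
From mathcomp Require Import all_boot all_order all_algebra.
From mathcomp Require Import all_classical all_reals all_analysis.
From mathcomp Require Import measurable_realfun zify ring lra.
Import Order.TTheory GRing.Theory Num.Theory.
Import numFieldNormedType.Exports.
Local Open Scope classical_set_scope.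
Local Open Scope ring_scope.

(* For edge vectors [t_ij] from vertex [j] to vertex [i] and [a_i, a_j >= 1], the field
   [lambda^a t_ij / a!] is tangential on every face, and its divergence is
   [lambda^(a - e_i) / (a - e_i)! - lambda^(a - e_j) / (a - e_j)!]. The admissible
   exponents [a] of degree [k] are the integer points [a(S) >= f(S)], [a(V) = f(V)] for a
   supermodular set function [f]; the exchange property of such base polytopes makes
   the graph of all these differences connected, so that the divergences, together
   with a single monomial, span the bubble space of degree [k - 1].

   The integral of [div v] vanishes because it is the limit of integrals of
   difference quotients of [v] extended by zero, which are 0 by translation
   invariance of the Lebesgue measure. Since a monomial has positive integral on [T],
   a function of zero mean has no component along it. *)

(** The obstacle in the integral is that only the normal component of [v] vanishes on the boundary:
    extended by zero, [v] jumps across the faces, and a difference quotient with step [s] can have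
    size [1 / s] in a layer of width [s]. Hence [v] is resolved along the edges from vertex 0. The
    component [p l] along the edge to vertex [l] vanishes on the face opposite to [l], and a step
    along this edge can cross only that face and the face opposite to vertex 0. On the latter the
    single terms do blow up, but their sum is [p 0 x / s], where [p 0], minus the sum of the other
    components, vanishes on that face. It is the sum over all edges that is bounded uniformly in
    [s], so that dominated convergence applies. On the combinatorial side, the inequalities on [r2]
    and [k] ensure, up to one unit in boundary cases, that the bounds on [mass a S] are convex in
    [#|S|]. *)

Set Implicit Arguments.
Unset Strict Implicit.

(** * Exchange and connectedness in base polytopes of supermodular functions *)

Section SupermodularExchange.
Local Open Scope nat_scope.
Variable I : finType.

Definition mass (a : {ffun I -> nat}) (S : {set I}) : nat := \sum_(i in S) a i.

Definition supermodular (f : {set I} -> nat) : Prop :=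
  forall S S', f S + f S' <= f (S :&: S')%SET + f (S :|: S')%SET.

Definition mi_inc (a : {ffun I -> nat}) i : {ffun I -> nat} :=
  [ffun l => a l + (l == i)].

Definition mi_dec (a : {ffun I -> nat}) i : {ffun I -> nat} :=
  [ffun l => a l - (l == i)].

Lemma massUI (a : {ffun I -> nat}) (S S' : {set I}) :
  mass a (S :&: S')%SET + mass a (S :|: S')%SET = mass a S + mass a S'.
Proof.
pose m (X : {set I}) := \sum_(i in X) a i.
have mID X Y : m X = m (X :&: Y)%SET + m (X :\: Y)%SET by exact: big_setID.
rewrite /mass -!/(m _) (mID S S') (mID (S :|: S')%SET S).
have -> : ((S :|: S') :&: S)%SET = S by apply/setP=> x; rewrite !inE; lia.
have -> : ((S :|: S') :\: S)%SET = (S' :\: S)%SET.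
  by apply/setP=> x; rewrite !inE; lia.
by rewrite (mID S' S) (finset.setIC S' S) (mID S S'); lia.
Qed.

Lemma sum_delta (i : I) (S : {set I}) : \sum_(l in S) (l == i : nat) = (i \in S).
Proof.
case: (boolP (i \in S)) => iS.
  by rewrite (bigD1 i) //= eqxx big1 // => l /andP[_ /negPf ->].
by rewrite big1 // => l lS; case: eqP => // li; rewrite li (negPf iS) in lS.
Qed.

Lemma mass_inc (a : {ffun I -> nat}) i (S : {set I}) :
  mass (mi_inc a i) S = mass a S + (i \in S).
Proof.
rewrite /mass; under eq_bigr do rewrite ffunE.
by rewrite big_split /= sum_delta.
Qed.

Lemma mi_decK (a : {ffun I -> nat}) i : 0 < a i -> mi_inc (mi_dec a i) i = a.
Proof.
by move=> ai; apply/ffunP=> l; rewrite !ffunE; case: eqP => [->|_] /=; lia.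
Qed.

Lemma mass_dec (a : {ffun I -> nat}) i (S : {set I}) :
  0 < a i -> mass a S = mass (mi_dec a i) S + (i \in S).
Proof. by move=> ai; rewrite -[in LHS](mi_decK ai) mass_inc. Qed.

Variable f : {set I} -> nat.
Hypothesis sf : supermodular f.

(** A member of least cardinality cannot shrink when intersected with another member. *)
Lemma setI_closed_least (P : pred {set I}) S1 :
  P S1 -> (forall S S', P S -> P S' -> P (S :&: S')%SET) ->
  exists2 S0, P S0 & forall S, P S -> S0 \subset S.
Proof.
move=> PS1 PI; case: (arg_minnP (fun S : {set I} => #|S|) PS1) => S0 PS0 S0min.
exists S0 => // S PS.
apply/finset.setIidPl/eqP.
by rewrite eqEcard finset.subsetIl S0min // PI.
Qed.

(* The witness [j] lies in the least tight set containing [i]; it exists because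
   [a'] has no less mass than [a] there. *)
Lemma exchange (a a' : {ffun I -> nat}) i :
  (forall S, f S <= mass a S) -> (forall S, f S <= mass a' S) ->
  mass a [set: I] = f [set: I] -> a' i < a i ->
  exists2 j, a j < a' j & forall S, f S <= mass (mi_inc (mi_dec a i) j) S.
Proof.
move=> Pa Pa' aT ai.
pose P : pred {set I} := fun S => (i \in S) && (mass a S == f S).
have [|S S' /andP[iS /eqP tS] /andP[iS' /eqP tS']|S0 /andP[iS0 /eqP tS0] S0m] :=
  @setI_closed_least P [set: I].
- by rewrite /P finset.in_setT aT eqxx.
- rewrite /P inE iS iS' /=.
  (* Mass is modular and [f] supermodular, so tightness of [S] and [S'] forces tightness of their
     intersection and union. *)
  have := sf S S'; have := massUI a S S'.
  have := Pa (S :&: S')%SET; have := Pa (S :|: S')%SET; lia.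
have [j jS0 aj] : exists2 j, j \in S0 & a j < a' j.
  apply/exists_inP; apply: contraLR (Pa' S0); rewrite negb_exists_in => /forall_inP aS0.
  rewrite -tS0 -ltnNge /mass (bigD1 i) //= [X in _ < X](bigD1 i) //=.
  rewrite -addSn leq_add // leq_sum // => j /andP[jS0 _].
  by rewrite leqNgt aS0.
exists j => // S.
have ai0 : 0 < a i by lia.
rewrite mass_inc; have := Pa S; have := mass_dec S ai0.
(* Only sets containing [i] but not [j] lose mass. A tight set containing [i] includes [S0], hence
   [j]; a set that is not tight can spare one unit. *)
have [iS|] := boolP (i \in S); last lia.
have [tS|] := eqVneq (mass a S) (f S); last lia.
by rewrite (fintype.subsetP (S0m S _) j jS0) ?/P ?iS ?tS ?eqxx//; lia.
Qed.

(* Two disjoint sets cannot both be deficient by supermodularity, so the deficient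
   sets have a least element, any point of which will do. *)
Lemma augment (b : {ffun I -> nat}) : f finset.set0 = 0 ->
  (forall S, S != finset.set0 -> f S <= (mass b S).+1) ->
  (mass b [set: I]).+1 = f [set: I] ->
  exists i, forall S, f S <= mass (mi_inc b i) S.
Proof.
move=> f0 Pb bT.
have Pb' S : 0 < f S -> f S <= (mass b S).+1.
  by move=> fS; apply: Pb; apply/eqP => S0; rewrite S0 f0 in fS.
have b0 : mass b finset.set0 = 0 by rewrite /mass finset.big_set0.
pose P : pred {set I} := fun S => (mass b S).+1 == f S.
have [|S S' /eqP tS /eqP tS'|S0 /eqP tS0 S0m] := @setI_closed_least P [set: I].
- by rewrite /P bT.
- have := sf S S'; have := massUI b S S'; have := Pb' (S :|: S')%SET.
  have := Pb' (S :&: S')%SET; rewrite /P; lia.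
have /set0Pn [i iS0] : S0 != finset.set0.
  by apply/eqP => S00; move: tS0; rewrite S00 b0 f0.
exists i => S; rewrite mass_inc; have [tS|] := eqVneq (mass b S).+1 (f S).
  by rewrite (fintype.subsetP (S0m S _) i iS0) ?/P ?tS; lia.
have [->|/Pb] := eqVneq S finset.set0; [by rewrite f0|lia].
Qed.

Definition in_base (a : {ffun I -> nat}) : Prop :=
  (forall S, f S <= mass a S) /\ mass a [set: I] = f [set: I].

Lemma mi_incK (a : {ffun I -> nat}) i : mi_dec (mi_inc a i) i = a.
Proof. by apply/ffunP=> l; rewrite !ffunE addnK. Qed.

(** Induction on the excess of [a] over [a']. Within [a] one passes from index [i] to [i0]; the
    result is also the exchanged point [a2] with [j] lowered, so the same vertex of the graph is now
    seen from a base point nearer to [a']. *)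
Lemma dec_connected (E : {ffun I -> nat} -> {ffun I -> nat} -> Prop) :
  (forall b, E b b) -> (forall b1 b2 b3, E b1 b2 -> E b2 b3 -> E b1 b3) ->
  (forall a i j, in_base a -> 0 < a i -> 0 < a j -> E (mi_dec a i) (mi_dec a j)) ->
  forall a a' i i', in_base a -> in_base a' -> 0 < a i -> 0 < a' i' ->
  E (mi_dec a i) (mi_dec a' i').
Proof.
move=> Er Et Ee a a' i i' Pa Pa'; have [n] := ubnP (\sum_l (a l - a' l)).
elim: n a i Pa => // n IH a i Pa dn ai ai'.
have sumT (c : {ffun I -> nat}) : mass c [set: I] = \sum_l c l.
  by rewrite /mass; apply: eq_bigl => l; rewrite finset.in_setT.
have [/existsP[i0 ai0]|] := boolP [exists l, a' l < a l].
  have [j aj Pa2] := exchange Pa.1 Pa'.1 Pa.2 ai0.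
  have ai00 : 0 < a i0 by lia.
  set a2 := mi_inc (mi_dec a i0) j in Pa2.
  have a2j : 0 < a2 j by rewrite !ffunE eqxx addn1.
  apply: Et (Ee _ _ i0 Pa ai ai00) _; rewrite -(mi_incK (mi_dec a i0) j).
  apply: IH => //.
    split=> //; rewrite mass_inc -Pa.2 finset.in_setT.
    by rewrite (mass_dec [set: I]%SET ai00) finset.in_setT.
  (* The excess drops by one at [i0] and does not grow at [j], where [a j < a' j]. *)
  rewrite (bigD1 i0) //=; move: dn; rewrite (bigD1 i0) //= => dn.
  have : \sum_(l | l != i0) (a2 l - a' l) <= \sum_(l | l != i0) (a l - a' l).
    apply: leq_sum => l /negPf li0; rewrite !ffunE li0; case: eqP => [->|]; lia.
  rewrite -/a2; have -> : a2 i0 = (a i0).-1.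
    rewrite !ffunE eqxx; case: eqP => [ij|] /=; last lia.
    by move: aj ai0; rewrite -ij; lia.
  by move: dn; set x := \sum_(_ | _) _; set y := \sum_(_ | _) _; lia.
rewrite negb_exists => /forallP aa'.
have le_aa' l : a l <= a' l by have := aa' l; lia.
have /eqP := Pa'.2; rewrite -Pa.2 !sumT => /eqP eq_sum.
(* Without excess [a] lies below [a'], and equal total mass makes them equal. *)
suff aE : a = a' by rewrite aE in ai Pa *; exact: Ee.
apply/ffunP => l; apply/eqP; rewrite eqn_leq le_aa' /=.
move: eq_sum; rewrite (bigD1 l) //= [in RHS](bigD1 l) //=.
have : \sum_(j | j != l) a j <= \sum_(j | j != l) a' j by exact: leq_sum.
set x := \sum_(_ | _) _; set y := \sum_(_ | _) _; lia.
Qed.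

(** By [augment], every such [b] is a base point with one entry lowered, which brings it under
    [dec_connected]. *)
Lemma base_connected (E : {ffun I -> nat} -> {ffun I -> nat} -> Prop) :
  f finset.set0 = 0 ->
  (forall b, E b b) -> (forall b1 b2 b3, E b1 b2 -> E b2 b3 -> E b1 b3) ->
  (forall a i j, in_base a -> 0 < a i -> 0 < a j -> E (mi_dec a i) (mi_dec a j)) ->
  forall b b',
  (forall S, S != finset.set0 -> f S <= (mass b S).+1) ->
  (mass b [set: I]).+1 = f [set: I] ->
  (forall S, S != finset.set0 -> f S <= (mass b' S).+1) ->
  (mass b' [set: I]).+1 = f [set: I] -> E b b'.
Proof.
move=> f0 Er Et Ee b b' Pb bT Pb' bT'.
have [i Pi] := augment f0 Pb bT; have [i' Pi'] := augment f0 Pb' bT'.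
rewrite -(mi_incK b i) -(mi_incK b' i').
by apply: dec_connected => //;
  rewrite ?/in_base ?mass_inc ?finset.in_setT ?addn1 // !ffunE eqxx addn1.
Qed.

End SupermodularExchange.

(** * Smoothness conditions as bounds depending on the cardinality *)

Section CardBounds.
Local Open Scope nat_scope.

Definition card_bound (h1 h2 h3 h4 : nat) (S : {set 'I_4}) : nat :=
  nth 0 [:: 0; h1; h2; h3; h4] #|S|.

(** For a function of the cardinality, supermodularity is convexity of the sequence
    [0, h1, h2, h3, h4]; the hypotheses are its three second differences. *)
Lemma card_bound_supermodular (h1 h2 h3 h4 : nat) :
  h1.*2 <= h2 -> h2.*2 <= h1 + h3 -> h3.*2 <= h2 + h4 ->
  supermodular (card_bound h1 h2 h3 h4).
Proof.
move=> c1 c2 c3 S S'; rewrite /card_bound.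
have := cardsUI S S'; have := max_card (mem (S :|: S')%SET); rewrite card_ord.
have := subset_leq_card (finset.subsetIl S S').
have := subset_leq_card (finset.subsetIr S S').
move: #|(S :&: S')%SET| #|(S :|: S')%SET| #|S| #|S'| => x u y z xz xy u4.
(* In terms of the intersection size [x] and the sizes [p], [q] of the two differences, finitely
   many cases with [x + p + q <= 4] remain. *)
have [p ->] : exists p, y = x + p by exists (y - x); lia.
have [q ->] : exists q, z = x + q by exists (z - x); lia.
move=> e; have {e} eu : u = x + p + q by lia.
rewrite {}eu in xy u4 *.
by case: x p q {xz xy} u4 => [|[|[|[|[|x]]]]] [|[|[|[|[|p]]]]] [|[|[|[|[|q]]]]] //=;
  rewrite ?(addSn, addnS, add0n, addn0) //=; lia.
Qed.

Lemma card_bound0 (h1 h2 h3 h4 : nat) : card_bound h1 h2 h3 h4 finset.set0 = 0.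
Proof. by rewrite /card_bound finset.cards0. Qed.

Lemma card_boundT (h1 h2 h3 h4 : nat) : card_bound h1 h2 h3 h4 [set: 'I_4]%SET = h4.
Proof. by rewrite /card_bound finset.cardsT card_ord. Qed.

Lemma mi_dist_mass (a : multi_index) g : mi_dist a g = mass a (~: g)%SET.
Proof. by apply: eq_bigl => l; rewrite finset.inE. Qed.

Lemma mi_size_mass (a : multi_index) : mi_size a = mass a [set: 'I_4]%SET.
Proof. by apply: eq_bigl => l; rewrite finset.inE. Qed.

(** The distance to a subsimplex is the mass of the complementary indices, so vertices give sets of
    size 3 and faces give singletons. *)
Lemma admissibleP (k : int) (r : smoothness) (a : multi_index) :
  admissible k r a <->
  [/\ (mass a [set: 'I_4]%SET)%:Z = k,
      forall S : {set 'I_4}, #|S| = 1 -> (sm_f r < (mass a S)%:Z)%R,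
      forall S : {set 'I_4}, #|S| = 2 -> (sm_e r < (mass a S)%:Z)%R
    & forall S : {set 'I_4}, #|S| = 3 -> (sm_v r < (mass a S)%:Z)%R].
Proof.
have cC (S : {set 'I_4}) : #|S| + #|(~: S)%SET| = 4 by rewrite finset.cardsC card_ord.
rewrite /admissible mi_size_mass; split=> -[ak a1 a2 a3]; split=> // S cS;
  have := cC S.
- by move=> cSC; have := a3 (~: S)%SET; rewrite mi_dist_mass finset.setCK; apply; lia.
- by move=> cSC; have := a2 (~: S)%SET; rewrite mi_dist_mass finset.setCK; apply; lia.
- by move=> cSC; have := a1 (~: S)%SET; rewrite mi_dist_mass finset.setCK; apply; lia.
- by move=> cSC; rewrite mi_dist_mass; apply: a3; lia.
- by move=> cSC; rewrite mi_dist_mass; apply: a2; lia.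
- by move=> cSC; rewrite mi_dist_mass; apply: a1; lia.
Qed.

(* The lower bounds [r2 + 1] on [mass a S], as functions of [#|S|], are not always
   convex. Raising a bound from 0 to 1 repairs this: it restricts [a], but every
   admissible [b] still extends, as [mass b S + 1 >= 1] always holds. For
   [r2 = (0, -1, -1)] and [k = 1] no bound works, but then [b = 0] is the only
   index. *)
Lemma admissible_connected (r2 : smoothness) (k : int)
    (E : multi_index -> multi_index -> Prop) :
  (Num.max (2 * sm_v r2 + 1) 1 <= k)%R ->
  ([\/ [/\ 0 <= sm_f r2, 2 * sm_f r2 + 1 <= sm_e r2 & 2 * sm_e r2 <= sm_v r2],
      [/\ sm_f r2 = -1, 1 <= sm_e r2 & 2 * sm_e r2 <= sm_v r2]
    | [/\ sm_f r2 = -1, sm_e r2 = 0 \/ sm_e r2 = -1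
        & 2 * sm_e r2 + 1 <= sm_v r2]])%R ->
  (forall b, E b b) -> (forall b1 b2 b3, E b1 b2 -> E b2 b3 -> E b1 b3) ->
  (forall a i j, admissible k r2 a -> 0 < a i -> 0 < a j ->
     E (mi_dec a i) (mi_dec a j)) ->
  forall b b', admissible (k - 1)%R (sm_ominus1 r2) b ->
    admissible (k - 1)%R (sm_ominus1 r2) b' -> E b b'.
Proof.
case: r2 => rv re rf; rewrite /sm_ominus1 /ominus1 /=.
move=> hk hr Er Et Ee b b' /admissibleP[/= bT b1 b2 b3] /admissibleP[/= b'T b'1 b'2 b'3].
have card_ind (S : {set 'I_4}) (P : nat -> Prop) :
    #|S| != 0 -> (#|S| = 1 -> P 1) -> (#|S| = 2 -> P 2) -> (#|S| = 3 -> P 3) ->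
    (S = [set: 'I_4]%SET -> P 4) -> P #|S|.
  have : #|S| <= 4 by rewrite -[X in _ <= X](card_ord 4) max_card.
  have : #|S| = 4 -> S = [set: 'I_4]%SET.
    by move=> S4; apply/eqP; rewrite eqEcard finset.subsetT finset.cardsT card_ord S4.
  by case: #|S| => [|[|[|[|[|]]]]] //; auto.
(* The strict bounds [r < h] make base points admissible. The bounds [h <= max (r + 1) 1] let every
   [b] extend: the mass of [b] is at least both [r] and 0. *)
have main h1 h2 h3 h4 : h4%:Z = k ->
    h1.*2 <= h2 -> h2.*2 <= h1 + h3 -> h3.*2 <= h2 + h4 ->
    (rf < h1%:Z)%R -> (re < h2%:Z)%R -> (rv < h3%:Z)%R ->
    (h1%:Z <= Num.max (rf + 1) 1)%R -> (h2%:Z <= Num.max (re + 1) 1)%R ->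
    (h3%:Z <= Num.max (rv + 1) 1)%R -> E b b'.
  move=> h4k c1 c2 c3 rf1 re2 rv3 h1f h2e h3v.
  have T1 : (mass b [set: 'I_4]%SET).+1 = h4 by lia.
  have T2 : (mass b' [set: 'I_4]%SET).+1 = h4 by lia.
  apply: (base_connected (card_bound_supermodular c1 c2 c3));
    rewrite ?card_bound0 ?card_boundT //.
  - move=> a i j [Pa aT]; apply: Ee; apply/admissibleP; split=> /=.
    + by rewrite aT card_boundT.
    + move=> S cS; have := Pa S; rewrite /card_bound cS /= => hS.
      by apply: lt_le_trans rf1 _; rewrite lez_nat.
    + move=> S cS; have := Pa S; rewrite /card_bound cS /= => hS.
      by apply: lt_le_trans re2 _; rewrite lez_nat.
    + move=> S cS; have := Pa S; rewrite /card_bound cS /= => hS.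
      by apply: lt_le_trans rv3 _; rewrite lez_nat.
  - move=> S S0.
    apply: (card_ind S (fun n => nth 0 [:: 0; h1; h2; h3; h4] n <= (mass b S).+1)) => /=.
    + by rewrite cards_eq0.
    + by move/b1; lia.
    + by move/b2; lia.
    + by move/b3; lia.
    + by move=> ->; lia.
  - move=> S S0.
    apply: (card_ind S (fun n => nth 0 [:: 0; h1; h2; h3; h4] n <= (mass b' S).+1)) => /=.
    + by rewrite cards_eq0.
    + by move/b'1; lia.
    + by move/b'2; lia.
    + by move/b'3; lia.
    + by move=> ->; lia.
case: hr => [[f0 ef ve]|[f1 e1 ve]|[f1 [e0|e1] ve]].
- by apply: (main (absz (rf + 1)%R) (absz (re + 1)%R) (absz (rv + 1)%R) (absz k)); lia.
(* With [h1 = rf + 1 = 0], the condition on [h2.*2] would fail for [rv = 2 * re]. *)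
- by apply: (main 1 (absz (re + 1)%R) (absz (rv + 1)%R) (absz k)); lia.
- by apply: (main 0 1 (absz (rv + 1)%R) (absz k)); lia.
have [v1|v1] := leP 1%R rv.
  (* With [h2 = re + 1 = 0], the condition on [h3.*2] would fail for [k = 2 * rv + 1]. *)
  by apply: (main 0 1 (absz (rv + 1)%R) (absz k)); lia.
have [v0|vm1] : rv = 0 \/ rv = (-1)%R by lia.
  have [k2|k1] := leP 2%R k; first by apply: (main 0 0 1 (absz k)); lia.
  have zero (c : multi_index) : (mass c [set: 'I_4]%SET)%:Z = (k - 1)%R -> c = [ffun=> 0].
    move=> cT; have {cT} : mass c [set: 'I_4]%SET = 0 by lia.
    move/eqP; rewrite /mass sum_nat_eq0 => /forallP c0; apply/ffunP => l.
    by have := c0 l; rewrite finset.inE ffunE => /eqP.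
  by rewrite (zero _ bT) (zero _ b'T).
by apply: (main 0 0 0 (absz k)); lia.
Qed.

End CardBounds.

(** * Translation invariance of the three-dimensional Lebesgue measure *)

Section Translation.
Variable R : realType.
Implicit Types a b c : R.

Definition shift1 a (x : measurableTypeR R) : measurableTypeR R := x + a.

Lemma measurable_shift1 a : measurable_fun setT (shift1 a).
Proof. exact: measurable_funD. Qed.

HB.instance Definition _ a :=
  isMeasurableFun.Build _ _ _ _ (shift1 a) (measurable_shift1 a).

Lemma lebesgue_measure_shift a (A : set (measurableTypeR R)) : measurable A ->
  pushforward (@lebesgue_measure R) (shift1 a) A = lebesgue_measure A.
Proof.
move=> mA; apply/esym/lebesgue_measure_unique => //= _ [[x y]] _ <-.
rewrite /pushforward.
have -> : shift1 a @^-1` `]x, y]%classic = `]x - a, y - a]%classic.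
  by apply/seteqP; split=> z /=; rewrite !in_itv /= /shift1 ltrBlDr lerBrDr.
by rewrite !lebesgue_measure_itv/= !lte_fin ltrD2r; congr (if _ then _%:E else _); ring.
Qed.

Definition shift3 (u : R * R * R)
    (t : measurableTypeR R * measurableTypeR R * measurableTypeR R) :
    measurableTypeR R * measurableTypeR R * measurableTypeR R :=
  (shift1 u.1.1 t.1.1, shift1 u.1.2 t.1.2, shift1 u.2 t.2).

Lemma measurable_shift3 u : measurable_fun setT (shift3 u).
Proof.
apply: measurable_fun_pair; first apply: measurable_fun_pair.
- apply: (measurableT_comp (measurable_shift1 _)).
  by apply: (measurableT_comp measurable_fst); exact: measurable_fst.
- apply: (measurableT_comp (measurable_shift1 _)).
  by apply: (measurableT_comp measurable_snd); exact: measurable_fst.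
- by apply: (measurableT_comp (measurable_shift1 _)); exact: measurable_snd.
Qed.

HB.instance Definition _ u :=
  isMeasurableFun.Build _ _ _ _ (shift3 u) (measurable_shift3 u).

Definition shift2 (u : R * R) (t : measurableTypeR R * measurableTypeR R) :
    measurableTypeR R * measurableTypeR R :=
  (shift1 u.1 t.1, shift1 u.2 t.2).

Lemma measurable_shift2 u : measurable_fun setT (shift2 u).
Proof.
apply: measurable_fun_pair.
  by apply: (measurableT_comp (measurable_shift1 _)); exact: measurable_fst.
by apply: (measurableT_comp (measurable_shift1 _)); exact: measurable_snd.
Qed.

HB.instance Definition _ u :=
  isMeasurableFun.Build _ _ _ _ (shift2 u) (measurable_shift2 u).

(** A product measure is determined by its values on rectangles, where the one-dimensional
    invariance applies to each side. *)
Lemma lebesgue2_shift u A : measurable A ->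
  pushforward (@lebesgue2 R) (shift2 u) A = lebesgue2 A.
Proof.
move=> mA; apply/esym/product_measure_unique => //= X Y mX mY.
have -> : pushforward (@lebesgue2 R) (shift2 u) (X `*` Y) =
    @lebesgue2 R ((shift1 u.1 @^-1` X) `*` (shift1 u.2 @^-1` Y)) by [].
have mX' : measurable (shift1 u.1 @^-1` X).
  by rewrite -[X in measurable X]setTI; exact: measurable_shift1.
have mY' : measurable (shift1 u.2 @^-1` Y).
  by rewrite -[X in measurable X]setTI; exact: measurable_shift1.
rewrite /lebesgue2 product_measure1E //.
by congr (_ * _)%E; apply: lebesgue_measure_shift.
Qed.

Lemma lebesgue3_shift u A : measurable A ->
  pushforward (@lebesgue3 R) (shift3 u) A = lebesgue3 A.
Proof.
move=> mA; apply/esym/product_measure_unique => //= X Y mX mY.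
have -> : pushforward (@lebesgue3 R) (shift3 u) (X `*` Y) =
    @lebesgue3 R ((shift2 u.1 @^-1` X) `*` (shift1 u.2 @^-1` Y)) by [].
have mX' : measurable (shift2 u.1 @^-1` X).
  by rewrite -[X in measurable X]setTI; exact: measurable_shift2.
have mY' : measurable (shift1 u.2 @^-1` Y).
  by rewrite -[X in measurable X]setTI; exact: measurable_shift1.
rewrite /lebesgue3 product_measure1E //.
congr (_ * _)%E; [exact: lebesgue2_shift|exact: lebesgue_measure_shift].
Qed.

(** The change of variables for signed functions in [integral_shift3] requires this; it follows from
    the nonnegative case applied to the absolute value. *)
Lemma integrable_shift3 u (f : R * R * R -> \bar R) :
  (@lebesgue3 R).-integrable setT f -> (@lebesgue3 R).-integrable setT (f \o shift3 u).
Proof.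
move=> /integrableP[mf fi]; apply/integrableP; split.
  exact: measurableT_comp mf (measurable_shift3 u).
have := @ge0_integral_pushforward _ _ _ _ _ _ (measurable_shift3 u) (@lebesgue3 R) setT
  (abse \o f) measurableT (measurableT_comp (@abse_measurable R setT) mf)
  (fun x _ => abse_ge0 _).
rewrite preimage_setT => <-.
rewrite (@eq_measure_integral _ _ _ _ (@lebesgue3 R)) // => A mA _.
exact: lebesgue3_shift.
Qed.

Lemma integral_shift3 u (f : R * R * R -> \bar R) :
  (@lebesgue3 R).-integrable setT f ->
  (\int[@lebesgue3 R]_t f (shift3 u t) = \int[@lebesgue3 R]_t f t)%E.
Proof.
move=> fi; have mf : measurable_fun setT f by case/integrableP: (fi).
have := @integral_pushforward _ _ _ _ _ _ (measurable_shift3 u) (@lebesgue3 R) setT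
  f mf (integrable_shift3 u fi) measurableT.
rewrite preimage_setT => <-.
apply: eq_measure_integral => A mA _; exact: lebesgue3_shift.
Qed.

End Translation.

(** * Cubes and bounded functions supported in them *)

Section Cubes.
Variable R : realType.
Implicit Types (c : R * R * R) (r : R).
Local Notation R3 := (measurableTypeR R * measurableTypeR R * measurableTypeR R)%type.

Definition cube c r : set R3 :=
  (`[c.1.1 - r, c.1.1 + r] `*` `[c.1.2 - r, c.1.2 + r]) `*` `[c.2 - r, c.2 + r].

Lemma cubeP c r t :
  cube c r t <-> [/\ `|t.1.1 - c.1.1| <= r, `|t.1.2 - c.1.2| <= r & `|t.2 - c.2| <= r].
Proof.
rewrite /cube /= !in_itv /= !ler_distl.
by split=> [[[-> ->] ->]|[-> -> ->]].
Qed.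

Lemma measurable_cube c r : measurable (cube c r).
Proof. by apply: measurableX; first apply: measurableX. Qed.

Lemma lebesgue3_cube c r : 0 < r -> lebesgue3 (cube c r) = ((2 * r) ^+ 3)%:E.
Proof.
move=> r0; have itvE (a : R) : lebesgue_measure `[a - r, a + r]%classic = (2 * r)%:E.
  by rewrite lebesgue_measure_itv /= lte_fin ifT; [congr _%:E; ring|lra].
have e2 : @lebesgue2 R (`[c.1.1 - r, c.1.1 + r] `*` `[c.1.2 - r, c.1.2 + r]) =
    ((2 * r) ^+ 2)%:E.
  rewrite /lebesgue2 product_measure1E //.
  by transitivity ((2 * r)%:E * (2 * r)%:E)%E => //; congr (_ * _)%E; exact: itvE.
rewrite /cube /lebesgue3 product_measure1E //; last exact: measurableX.
transitivity (((2 * r) ^+ 2)%:E * (2 * r)%:E)%E; last by rewrite -EFinM -exprSr.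
by congr (_ * _)%E; [exact: e2|exact: itvE].
Qed.

Lemma bounded_support_integrable c r M (F : R3 -> R) : 0 < r ->
  measurable_fun setT F -> (forall t, `|F t| <= M) ->
  (forall t, ~ cube c r t -> F t = 0) -> (@lebesgue3 R).-integrable setT (EFin \o F).
Proof.
move=> r0 mF FM F0.
have -> : EFin \o F = (EFin \o F) \_ (cube c r).
  apply/funext => t; have [tc|ntc] := pselect (cube c r t); first by rewrite patchT ?inE.
  by rewrite patchN ?notin_setE //= F0.
apply/(integrable_mkcond _ (measurable_cube c r)).
apply: measurable_bounded_integrable.
- exact: measurable_cube.
- by have := ltry ((2 * r) ^+ 3); rewrite -(lebesgue3_cube c r0).
- exact: measurable_funTS.
- by exists M; split=> [|N MN t _]; [exact: num_real|exact: le_trans (FM t) (ltW MN)].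
Qed.

End Cubes.

(** [uniq r] makes the condition [j != i] delete exactly one factor. *)
Lemma is_derive_prod (R : realType) (V : normedModType R) (I : eqType) (r : seq I)
    (f : I -> V -> R) (df : I -> R) (x w : V) :
  uniq r -> (forall i, is_derive x w (f i) (df i)) ->
  is_derive x w (fun y => \prod_(i <- r) f i y)
    (\sum_(i <- r) df i * \prod_(j <- r | j != i) f j x).
Proof.
move=> + dfE; elim: r => [_|i r IH /= /andP[ir ur]].
  rewrite big_nil (_ : (fun _ => _) = cst 1); first exact: is_derive_cst.
  by apply/funext => y; rewrite big_nil.
have -> : (fun y => \prod_(j <- i :: r) f j y) = f i * (fun y => \prod_(j <- r) f j y).
  by apply/funext => y; rewrite big_cons.
apply: is_derive_eq (is_deriveM (dfE i) (IH ur)) _.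
rewrite big_cons big_cons eqxx /= addrC; congr (_ + _).
  rewrite [LHS]mulrC; congr (_ * _); rewrite [RHS]big_seq_cond [LHS]big_seq.
  apply: eq_bigl => j; case: (boolP (j \in r)) => //= jr.
  by apply/esym; apply: contraNneq ir => <-.
rewrite [LHS]mulr_sumr; apply: eq_big_seq => j jr.
rewrite big_cons ifT; last by apply: contraNneq ir => ->.
by rewrite mulrCA.
Qed.

(** * Barycentric coordinates and their derivatives *)

Section Barycentric.
Variables (R : realType) (T : tetrahedron R).
Local Notation V := 'rV[R]_3.
Implicit Types (x w : V) (i j l : 'I_4).

(** The linear part of the affine function [bary i]: the homogeneous coordinate 0 marks a direction,
    as 1 marks a point. *)
Definition dbary i w : R := (row_mx w 0 *m invmx (vertex_mx T)) 0 i.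

Lemma dbary_is_linear i : scalar (dbary i).
Proof.
move=> c u v; rewrite /dbary.
have -> : row_mx (c *: u + v) 0 = c *: row_mx u 0 + row_mx v 0 :> 'rV[R]_(3 + 1).
  by rewrite scale_row_mx add_row_mx scaler0 addr0.
by rewrite mulmxDl -scalemxAl mxE [X in X + _]mxE.
Qed.

HB.instance Definition _ i :=
  GRing.isLinear.Build R V R *%R (dbary i) (dbary_is_linear i).

Lemma baryD i x w : bary T i (x + w) = bary T i x + dbary i w.
Proof.
rewrite /bary /dbary.
have -> : row_mx (x + w) 1 = row_mx x 1 + row_mx w 0 :> 'rV[R]_(3 + 1).
  by rewrite add_row_mx addr0.
by rewrite mulmxDl mxE.
Qed.

Lemma sum_dbary w : \sum_i dbary i w = 0.
Proof.
apply: (addrI (\sum_i bary T i 0)); rewrite addr0 -big_split /=.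
under eq_bigr do rewrite -baryD.
by rewrite !(bary_spec T _).2.
Qed.

Lemma sum_dbary_vertex w : \sum_i dbary i w *: vertex T i = w.
Proof.
apply: (addrI 0); rewrite -[in RHS](bary_spec T (0 + w)).1.
under [RHS]eq_bigr do rewrite baryD scalerDl.
by rewrite big_split /= (bary_spec T 0).1.
Qed.

Lemma bary_unique (c : 'I_4 -> R) i :
  \sum_j c j = 1 -> bary T i (\sum_j c j *: vertex T j) = c i.
Proof.
move=> c1; have := @mul_vertex_mx _ T (\row_j c j).
rewrite (eq_bigr (fun j => c j *: vertex T j)); last by move=> j _; rewrite mxE.
rewrite (eq_bigr c); last by move=> j _; rewrite mxE.
rewrite c1 => e; rewrite /bary -e mulmxK ?mxE //; exact: vertex_mx_unit.
Qed.

Lemma bary_vertex i j : bary T i (vertex T j) = (i == j)%:R.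
Proof.
have <- : \sum_l (l == j)%:R *: vertex T l = vertex T j.
  rewrite (bigD1 j) //= eqxx scale1r big1 ?addr0 // => l /negPf ->.
  by rewrite scale0r.
rewrite (@bary_unique (fun l => (l == j)%:R)) //.
by rewrite (bigD1 j) //= eqxx big1 ?addr0 // => l /negPf ->.
Qed.

Lemma dbary_edge i j l : dbary i (vertex T j - vertex T l) = (i == j)%:R - (i == l)%:R.
Proof.
have := baryD i (vertex T l) (vertex T j - vertex T l).
rewrite addrC subrK !bary_vertex => ->; ring.
Qed.

Lemma tetraE x : tetra T x <-> forall i, 0 <= bary T i x.
Proof.
split=> [[c [c0 c1 ->]] i|x0]; first by rewrite bary_unique.
by exists (bary T ^~ x); have [xE x1] := bary_spec T x; split.
Qed.

Lemma faceE i x : face T i x <-> tetra T x /\ bary T i x = 0.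
Proof.
rewrite tetraE; split=> [[c [c0 ci c1 ->]]|[x0 xi]].
  by split=> [j|]; rewrite bary_unique.
by exists (bary T ^~ x); have [xE x1] := bary_spec T x; split.
Qed.

Lemma is_derive_bary i x w : is_derive x w (bary T i) (dbary i w).
Proof.
suff h : (fun h : R => h^-1 *: (bary T i (h *: w + x) - bary T i x)) @ 0^' --> dbary i w.
  by split; [apply/cvg_ex; exists (dbary i w)|exact: cvg_lim].
apply: cvg_near_cst; near=> h.
rewrite [_ *: w + x]addrC baryD linearZ /= addrAC subrr add0r [LHS]mulKf //.
near: h; exact: nbhs_dnbhs_neq.
Unshelve. all: by end_near. Qed.

Lemma bary_monomial_dec a i x :
  bary_monomial T (mi_dec a i) x =
  bary T i x ^+ (a i).-1 * \prod_(j | j != i) bary T j x ^+ a j.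
Proof.
rewrite /bary_monomial (bigD1 i) //= ffunE eqxx subn1; congr (_ * _).
by apply: eq_bigr => j /negPf ji; rewrite ffunE ji subn0.
Qed.

(** When [a i = 0] the truncated [mi_dec a i] equals [a], but its coefficient is zero. *)
Lemma is_derive_bary_monomial a x w :
  is_derive x w (bary_monomial T a)
    (\sum_i dbary i w * (a i)%:R * bary_monomial T (mi_dec a i) x).
Proof.
have df i : is_derive x w (fun y => bary T i y ^+ a i)
    (dbary i w * (a i)%:R * bary T i x ^+ (a i).-1).
  have -> : (fun y => bary T i y ^+ a i) = bary T i ^+ a i.
    by apply/funext => y; rewrite exprfctE.
  apply: is_derive_eq (is_deriveX (a i) (is_derive_bary i x w)) _.
  by rewrite [_ *: _]mulrC mulrA.
apply: (is_derive_eq (is_derive_prod (index_enum_uniq _) df)).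
by apply: eq_bigr => i _; rewrite bary_monomial_dec mulrA.
Qed.

End Barycentric.

(** * Linear spans *)

Section LinSpan.
Variables (R : realType) (V : lmodType R).
Implicit Types (A : set V) (u v : V).

Lemma lin_span0 A : lin_span A 0.
Proof. by exists 0%N, (fun=> 0), (fun=> 0); split=> [[]//|]; rewrite big_ord0. Qed.

Lemma lin_spanPZ A c u v : A u -> lin_span A v -> lin_span A (c *: u + v).
Proof.
move=> Au [n [d [w [Aw ->]]]].
exists n.+1, (fun i => oapp d c (unlift ord0 i)), (fun i => oapp w u (unlift ord0 i)).
split=> [i|]; first by case: unliftP => [j|] _ /=.
rewrite big_ord_recl unlift_none /=; congr (_ + _).
by apply: eq_bigr => i _; rewrite liftK.
Qed.

Lemma lin_span_ind A (P : V -> Prop) :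
  P 0 -> (forall c u v, A u -> P v -> P (c *: u + v)) ->
  forall u, lin_span A u -> P u.
Proof.
move=> P0 PZ _ [n [c [v [Av ->]]]]; elim: n c v Av => [|n IH] c v Av.
  by rewrite big_ord0.
by rewrite big_ord_recl; apply: PZ => //; exact: IH.
Qed.

Lemma lin_span_base A u : A u -> lin_span A u.
Proof.
move=> Au; rewrite -[u]scale1r -[_ *: _]addr0.
by apply: lin_spanPZ => //; exact: lin_span0.
Qed.

Lemma lin_spanP A c u v : lin_span A u -> lin_span A v -> lin_span A (c *: u + v).
Proof.
move=> Au Av; elim/lin_span_ind : Au => [|d {}u w Au IH]; first by rewrite scaler0 add0r.
by rewrite scalerDr scalerA -addrA; exact: lin_spanPZ.
Qed.

Lemma lin_spanZ A c u : lin_span A u -> lin_span A (c *: u).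
Proof.
move=> Au; rewrite -[_ *: _]addr0.
by apply: lin_spanP => //; exact: lin_span0.
Qed.

Lemma lin_spanD A u v : lin_span A u -> lin_span A v -> lin_span A (u + v).
Proof. by move=> Au; rewrite -[u]scale1r; exact: lin_spanP. Qed.

Lemma lin_span_sum A (I : Type) (r : seq I) (P : pred I) (F : I -> V) :
  (forall i, P i -> lin_span A (F i)) -> lin_span A (\sum_(i <- r | P i) F i).
Proof. by move=> AF; elim/big_ind : _ => //; [exact: lin_span0|exact: lin_spanD]. Qed.

Lemma lin_spanS A B : A `<=` B -> lin_span A `<=` lin_span B.
Proof. by move=> AB u [n [c [v [Av ->]]]]; exists n, c, v; split=> // i; exact: AB. Qed.

End LinSpan.

(** * Polynomials in barycentric coordinates: derivatives, estimates, measurability *)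

Section BarycentricPolynomials.
Variables (R : realType) (T : tetrahedron R).
Local Notation V := 'rV[R]_3.
Implicit Types (x w : V) (i j l : 'I_4) (Q : set multi_index).

(** [Q] records the allowed exponents: [admissible k r] gives the bubble space, [setT] all
    polynomials in the barycentric coordinates. *)
Definition mono_span Q : set (V -> R) := lin_span [set bary_monomial T a | a in Q].

(** The three claims share one induction, since differentiating a sum needs the derivability of the
    part already treated. *)
Lemma derive_mono_span Q Q' (f : V -> R) :
  (forall a i, Q a -> (0 < a i)%N -> Q' (mi_dec a i)) -> mono_span Q f ->
  [/\ forall x w, derivable f x w, forall w, mono_span Q' (fun x => 'D_w f x)
    & forall x c w w', 'D_(c *: w + w') f x = c * 'D_w f x + 'D_w' f x].
Proof.
move=> QQ'; elim/lin_span_ind => [|c u v [a Qa <-] [dv Dv linv]].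
  have D0 x w : is_derive x w (0 : V -> R) 0 by exact: is_derive_cst.
  split=> [x w|w|x c w w']; first by case: (D0 x w).
    rewrite (_ : (fun _ => _) = 0); first exact: lin_span0.
    by apply/funext => x; rewrite (@derive_val _ _ _ _ _ _ _ (D0 x w)).
  by rewrite !(@derive_val _ _ _ _ _ _ _ (D0 _ _)) mulr0 addr0.
have dE x w : is_derive x w (c *: bary_monomial T a + v)
    (c * (\sum_i dbary T i w * (a i)%:R * bary_monomial T (mi_dec a i) x) + 'D_w v x).
  apply: is_deriveD; last exact: derivableP.
  exact: is_deriveZ (is_derive_bary_monomial T a x w).
have DE x w := @derive_val _ _ _ _ _ _ _ (dE x w).
split=> [x w|w|x d w w']; first by case: (dE x w).
  have -> : (fun x => 'D_w (c *: bary_monomial T a + v) x) =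
      c *: (\sum_i (dbary T i w * (a i)%:R) *: bary_monomial T (mi_dec a i))
      + (fun x => 'D_w v x) :> (V -> R).
    apply/funext => x; rewrite DE; congr (_ * _ + _).
    by rewrite fct_sumE.
  apply: lin_spanP; last exact: Dv.
  apply lin_span_sum => i _.
  have [ai|ai0] := posnP (a i).
    by rewrite ai mulr0 scale0r; exact: lin_span0.
  by apply: lin_spanZ; apply: lin_span_base; exists (mi_dec a i) => //; exact: QQ'.
pose S u := \sum_i dbary T i u * (a i)%:R * bary_monomial T (mi_dec a i) x.
have SE : S (d *: w + w') = d * S w + S w'.
  rewrite /S mulr_sumr -big_split; apply: eq_bigr => i _.
  by rewrite linearP /=; ring.
by rewrite !DE -!/(S _) SE linv; ring.
Qed.

Lemma is_derive_line (f : V -> R) x w (s : R) : (forall y, derivable f y w) ->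
  is_derive s 1 (fun r => f (x + r *: w)) ('D_w f (x + s *: w)).
Proof.
move=> df; have [c cE] := derivableP (df (x + s *: w)).
have e : (fun h : R => h^-1 *: (((fun r => f (x + r *: w)) \o shift s) (h *: 1) - f (x + s *: w)))
    = (fun h : R => h^-1 *: ((f \o shift (x + s *: w)) (h *: w) - f (x + s *: w))).
  apply/funext => h /=; congr (_ *: (f _ - _)).
  by rewrite [h *: 1]mulr1 scalerDl addrCA.
by split; [rewrite /derivable e|rewrite /derive e].
Qed.

Lemma tetra_convex x w (r s : R) : 0 <= r <= s -> tetra T x -> tetra T (x + s *: w) ->
  tetra T (x + r *: w).
Proof.
move=> /andP[r0 rs] /tetraE Tx /tetraE Ts; apply/tetraE => i.
have := Tx i; have := Ts i; rewrite !baryD !linearZ /=.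
have [d0|/ltW d0] := leP 0 (dbary T i w); first by nra.
by have := ler_wnM2r d0 rs; lra.
Qed.

Lemma bary_le1 i x : tetra T x -> bary T i x <= 1.
Proof.
move=> /tetraE Tx; rewrite -(bary_spec T x).2 (bigD1 i) //= lerDl.
by apply: sumr_ge0 => j _.
Qed.

Lemma mono_span_bounded Q (f : V -> R) : mono_span Q f ->
  exists2 M, 0 <= M & forall x, tetra T x -> `|f x| <= M.
Proof.
elim/lin_span_ind => [|c u v [a _ <-] [M M0 vM]].
  by exists 0 => // x _; rewrite normr0.
exists (`|c| + M) => [|x Tx]; first by rewrite addr_ge0.
apply: le_trans (ler_normD _ _) _; apply: lerD; last exact: vM.
rewrite normrM ler_piMr // ger0_norm; last first.
  by apply: prodr_ge0 => i _; rewrite exprn_ge0 //; move/tetraE: Tx.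
apply: prodr_ile1 => i _; rewrite exprn_ge0 ?exprn_ile1 ?bary_le1 //; by move/tetraE: Tx.
Qed.

Lemma mono_span_mvt Q (f : V -> R) w x s : mono_span Q f -> 0 <= s ->
  exists2 r, 0 <= r <= s & f (x + s *: w) - f x = 'D_w f (x + r *: w) * s.
Proof.
move=> Qf s0; have [df _ _] := @derive_mono_span Q setT f (fun _ _ _ _ => I) Qf.
have dl r := is_derive_line x r (fun y => df y w).
have [|r] := @MVT_segment _ (fun r => f (x + r *: w)) (fun r => 'D_w f (x + r *: w)) 0 s s0.
  apply: continuous_subspaceT => r; apply/differentiable_continuous/derivable1_diffP.
  by case: (dl r).
by rewrite in_itv scale0r addr0 subr0 => rs fE; exists r.
Qed.

(** The derivative is again a polynomial, hence bounded on the tetrahedron, which contains the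
    segment by convexity. *)
Lemma mono_span_lipschitz Q (f : V -> R) w : mono_span Q f ->
  exists2 M, 0 <= M & forall x s, 0 <= s -> tetra T x -> tetra T (x + s *: w) ->
    `|f (x + s *: w) - f x| <= M * s.
Proof.
move=> Qf; have [_ Df _] := @derive_mono_span Q setT f (fun _ _ _ _ => I) Qf.
have [M M0 DM] := mono_span_bounded (Df w); exists M => // x s s0 Tx Ts.
have [r rs ->] := mono_span_mvt w x Qf s0.
rewrite normrM (ger0_norm s0) ler_wpM2r //.
by apply: DM; apply: tetra_convex Tx Ts.
Qed.

(** The quotient is the derivative at an intermediate point, and the derivative is itself Lipschitz
    along [w]. *)
Lemma mono_span_taylor Q (f : V -> R) w : mono_span Q f ->
  exists2 M, 0 <= M & forall x s, 0 < s -> tetra T x -> tetra T (x + s *: w) ->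
    `|(f (x + s *: w) - f x) / s - 'D_w f x| <= M * s.
Proof.
move=> Qf; have [_ Df _] := @derive_mono_span Q setT f (fun _ _ _ _ => I) Qf.
have [M M0 DM] := mono_span_lipschitz w (Df w); exists M => // x s s0 Tx Ts.
have [r rs ->] := mono_span_mvt w x Qf (ltW s0); have /andP[r0 r_s] := rs.
rewrite mulfK ?gt_eqF //; apply: le_trans (DM x r r0 Tx _) _.
  exact: tetra_convex Tx Ts.
by rewrite ler_wpM2l.
Qed.

(* [x] is compared with its projection onto the face along an edge leading to the
   opposite vertex. *)
Lemma mono_span_face Q (f : V -> R) l : mono_span Q f ->
  (forall x, face T l x -> f x = 0) ->
  exists2 M, 0 <= M & forall x, tetra T x -> `|f x| <= M * bary T l x.
Proof.
move=> Qf f0; pose m := lift l ord0.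
have [M M0 fM] := mono_span_lipschitz (vertex T l - vertex T m) Qf.
exists M => // x Tx; have /tetraE Tx' := Tx.
set y := x - bary T l x *: (vertex T l - vertex T m).
have xE : x = y + bary T l x *: (vertex T l - vertex T m) by rewrite subrK.
have lm : (l == m) = false by apply/negbTE; exact: neq_lift.
have by_ i : bary T i y = bary T i x - bary T l x * ((i == l)%:R - (i == m)%:R).
  by rewrite /y -scaleNr baryD linearZ /= dbary_edge mulNr.
have Fy : face T l y.
  apply/faceE; split; last by rewrite by_ eqxx lm /=; ring.
  apply/tetraE => i; rewrite by_; have := Tx' i; have := Tx' l.
  case: (eqVneq i l) => [->|il]; first by rewrite lm /= => *; lra.
  by case: (i == m) => /= *; lra.
have Ty : tetra T y by case/faceE: Fy.
by have := fM y (bary T l x) (Tx' l) Ty; rewrite -xE (f0 y Fy) subr0; apply.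
Qed.

Lemma measurable_dbary i : measurable_fun setT (dbary T i \o @point3 R).
Proof.
have -> : dbary T i \o @point3 R =
    (fun t => \sum_j (@point3 R t) 0 j * dbary T i (delta_mx 0 j)).
  apply/funext => t /=; rewrite {1}[point3 t]row_sum_delta linear_sum /=.
  by apply: eq_bigr => j _; rewrite linearZ.
apply: measurable_sum => j; apply: measurable_funM; last exact: measurable_cst.
rewrite (_ : (fun t => _) = fun t : R * R * R => [tuple t.1.1; t.1.2; t.2]`_j); last first.
  by apply/funext => t; rewrite mxE.
case: j => [[|[|[|//]]] j3] /=.
- by apply: (measurableT_comp measurable_fst); exact: measurable_fst.
- by apply: (measurableT_comp measurable_snd); exact: measurable_fst.
- exact: measurable_snd.
Qed.

Lemma measurable_bary i : measurable_fun setT (bary T i \o @point3 R).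
Proof.
have -> : bary T i \o @point3 R = cst (bary T i 0) \+ (dbary T i \o @point3 R).
  by apply/funext => t /=; rewrite -baryD add0r.
apply: measurable_funD; [exact: measurable_cst|exact: measurable_dbary].
Qed.

Lemma measurable_mono_span Q (f : V -> R) : mono_span Q f ->
  measurable_fun setT (f \o @point3 R).
Proof.
elim/lin_span_ind => [|c u v [a _ <-] mv]; first exact: measurable_cst.
apply: (measurable_funD _ mv); apply: measurable_funM; first exact: measurable_cst.
apply: measurable_prod => i _; apply: measurable_funX; exact: measurable_bary.
Qed.

Lemma measurable_tetra : measurable (@point3 R @^-1` tetra T).
Proof.
have -> : @point3 R @^-1` tetra T =
    \bigcap_(i in [set: 'I_4]) [set t | 0 <= bary T i (point3 t)].
  apply/seteqP; split=> [t /tetraE Tt i _ /=|t Tt]; first exact: Tt.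
  by apply/tetraE => i; exact: Tt.
apply: fin_bigcap_measurable => // i _; rewrite -[X in measurable X]setTI.
have mle : measurable_fun setT (fun t => 0 <= (bary T i \o @point3 R) t).
  by apply: measurable_fun_ler; [exact: measurable_cst|exact: measurable_bary].
by have := mle measurableT [set true] => /(_ I).
Qed.

End BarycentricPolynomials.

(** * Passage between row vectors and coordinate triples *)

Section Coordinates.
Variables (R : realType) (T : tetrahedron R).
Local Notation V := 'rV[R]_3.
Implicit Types (x w : V).

Definition coords w : R * R * R := (w 0 0, w 0 1, w 0 2).

Lemma point3_shift w t : point3 (shift3 (coords w) t) = point3 t + w.
Proof. by apply/rowP => -[[|[|[|//]]] j3]; rewrite !mxE; congr (_ + w _ _); apply/val_inj. Qed.

Lemma tetra_coord_bound : exists2 N, 0 < N & forall x j, tetra T x -> `|x 0 j| <= N.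
Proof.
exists (1 + \sum_j \sum_i `|vertex T i 0 j|) => [|x j Tx].
  by rewrite ltr_wpDr // sumr_ge0 // => j _; rewrite sumr_ge0.
have Tx' := (tetraE T x).1 Tx.
rewrite -[in X in X <= _](bary_spec T x).1 summxE (bigD1 j) //=.
apply: le_trans (ler_norm_sum _ _ _) _.
apply: (@le_trans _ _ (\sum_i `|vertex T i 0 j|)).
  apply: ler_sum => i _; rewrite mxE normrM ler_piMl // ger0_norm //; exact: bary_le1.
rewrite addrCA lerDl addr_ge0 // sumr_ge0 // => k _; exact: sumr_ge0.
Qed.

Lemma cube0P r (t : R * R * R) : cube 0 r t <-> forall j, `|point3 t 0 j| <= r.
Proof.
rewrite cubeP !subr0; split=> [[t0 t1 t2] [[|[|[|//]]] j3]|tr]; rewrite ?mxE //.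
by have := tr 0; have := tr 1; have := tr 2; rewrite !mxE.
Qed.

Lemma restrict_tetra_point3 (f : V -> R) :
  (f \_ (tetra T)) \o @point3 R = (f \o @point3 R) \_ (@point3 R @^-1` tetra T).
Proof.
apply/funext => t /=; have [Tt|nTt] := pselect (tetra T (point3 t)).
  by rewrite !patchT ?inE.
by rewrite !patchN ?notin_setE.
Qed.

Lemma measurable_restrict_tetra Q (f : V -> R) : mono_span T Q f ->
  measurable_fun setT ((f \_ (tetra T)) \o @point3 R).
Proof.
move=> Qf; rewrite restrict_tetra_point3.
apply/(measurable_restrictT _ (measurable_tetra T)).
by apply: measurable_funTS; exact: measurable_mono_span Qf.
Qed.

Lemma integrable_restrict_tetra Q (f : V -> R) : mono_span T Q f ->
  (@lebesgue3 R).-integrable setT (EFin \o ((f \_ (tetra T)) \o @point3 R)).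
Proof.
move=> Qf; have [N N0 TN] := tetra_coord_bound; have [M M0 fM] := mono_span_bounded Qf.
apply: (@bounded_support_integrable _ 0 N M) => //.
- exact: measurable_restrict_tetra Qf.
- move=> t /=; have [Tt|nTt] := pselect (tetra T (point3 t)).
    by rewrite patchT ?inE //; exact: fM.
  by rewrite patchN ?notin_setE // normr0.
- move=> t nct /=; rewrite patchN // notin_setE => Tt; apply: nct.
  by apply/cube0P => j; exact: TN.
Qed.

End Coordinates.

(** * Vanishing integral of a divergence written along the edges from vertex 0 *)

Section DifferenceQuotient.
Variables (R : realType) (T : tetrahedron R).
Local Notation V := 'rV[R]_3.
Implicit Types (x w : V) (i j l : 'I_4) (s : R).

(** [p l] is the component of a field along [e l]. As [e 0 = 0], the term of index 0 adds nothing to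
    [D]; [p 0] is minus the sum of the other components, and its vanishing on the face opposite to
    vertex 0 expresses tangency there. *)
Variable p : 'I_4 -> V -> R.
Hypothesis p_span : forall l, mono_span T setT (p l).
Hypothesis p_face : forall l x, face T l x -> p l x = 0.
Hypothesis sum_p : forall x, \sum_l p l x = 0.

Let e l : V := vertex T l - vertex T 0.
Let D x := \sum_l 'D_(e l) (p l) x.
Let g l := p l \_ (tetra T).

(* The directional derivatives are taken at the shifted point [x + s *: e 1], which
   leaves [tetra T] when [x] is on the face opposite to vertex 0; this makes the
   defect tend to 0 everywhere, with no exceptional null set. *)
Definition quotient_defect s x : R :=
  \sum_l (g l (x + s *: e l) - g l x) / s - (D \_ (tetra T)) (x + s *: e 1).
Local Notation K := quotient_defect.

Lemma D_span : mono_span T setT D.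
Proof.
have -> : D = \sum_l (fun x => 'D_(e l) (p l) x) by apply/funext => x; rewrite fct_sumE.
apply lin_span_sum => l _.
have [_ Dp _] := @derive_mono_span _ T setT setT (p l) (fun _ _ _ _ => I) (p_span l).
exact: Dp.
Qed.

(** For [l != 0] a step trades coordinate 0 for coordinate [l], so it can enter the tetrahedron only
    through the face opposite to [l] and leave it only through the face opposite to 0. *)
Lemma bary_step i l x s :
  bary T i (x + s *: e l) = bary T i x + s * ((i == l)%:R - (i == 0)%:R).
Proof. by rewrite baryD linearZ /= dbary_edge. Qed.

Lemma tetra_step l x s : 0 <= s -> tetra T x -> s <= bary T 0 x -> tetra T (x + s *: e l).
Proof.
move=> s0 /tetraE Tx sx; apply/tetraE => i; rewrite bary_step.
have := Tx i; case: (eqVneq i 0) => [->|i0]; case: (_ == l) => /= *; lra.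
Qed.

Lemma tetra_step_out l x s : l != 0 -> bary T 0 x < s -> ~ tetra T (x + s *: e l).
Proof.
move=> l0 sx /tetraE/(_ 0); rewrite bary_step eqxx eq_sym (negPf l0) /=; lra.
Qed.

(** Here every step stays inside, so the Taylor estimates apply to each quotient; the shift by [e 1]
    costs one Lipschitz estimate for [D]. *)
Lemma quotient_defect_inner : exists2 C, 0 <= C &
  forall x s, 0 < s -> tetra T x -> s <= bary T 0 x -> `|K s x| <= C * s.
Proof.
have /choice[M MP] : forall l, exists M, 0 <= M /\ forall x s, 0 < s -> tetra T x ->
    tetra T (x + s *: e l) ->
    `|(p l (x + s *: e l) - p l x) / s - 'D_(e l) (p l) x| <= M * s.
  by move=> l; have [M] := mono_span_taylor (e l) (p_span l); exists M.
have [L L0 DL] := mono_span_lipschitz (e 1) D_span.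
exists (\sum_l M l + L) => [|x s s0 Tx sx].
  by rewrite addr_ge0 // sumr_ge0 // => l _; case: (MP l).
have Ts l : tetra T (x + s *: e l) by apply: tetra_step => //; exact: ltW.
have -> : K s x = \sum_l ((p l (x + s *: e l) - p l x) / s - 'D_(e l) (p l) x)
    - (D (x + s *: e 1) - D x).
  rewrite /K patchT ?inE // sumrB -/(D x).
  under eq_bigr do rewrite /g !patchT ?inE //.
  ring.
rewrite mulrDl; apply: le_trans (ler_normB _ _) _.
apply: lerD; last exact: DL (ltW s0) Tx (Ts 1).
rewrite mulr_suml; apply: le_trans (ler_norm_sum _ _ _) _; apply: ler_sum => l _.
by apply: (MP l).2.
Qed.

(* Along the face opposite to vertex 0 the steps all leave the tetrahedron, and
   the resulting boundary terms [- p l x / s] add up to [p 0 x / s]. *)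
Lemma quotient_defect_layer x s : 0 < s -> tetra T x -> bary T 0 x < s -> K s x = p 0 x / s.
Proof.
move=> s0 Tx xs; rewrite /K patchN ?subr0; last by rewrite notin_setE; exact: tetra_step_out.
rewrite (bigD1 0) //= /e subrr scaler0 addr0 subrr mul0r add0r -/(e _).
rewrite (eq_bigr (fun l => - p l x / s)) => [|l l0].
  by rewrite -mulr_suml sumrN; congr (_ / _); have := sum_p x; rewrite (bigD1 0) //=; lra.
rewrite /g patchN; last by rewrite notin_setE; exact: tetra_step_out.
by rewrite patchT ?inE // sub0r.
Qed.

(** An outside point has a negative coordinate, and a step along [e l] can repair only coordinate
    [l]. Where it lands inside, that coordinate is at most [s], so [p l] is of order [s] and offsets
    the division by [s]. *)
Lemma quotient_defect_outer : exists2 C, 0 <= C &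
  forall x s, 0 < s -> ~ tetra T x -> `|K s x| <= C.
Proof.
have /choice[M MP] : forall l, exists M,
    0 <= M /\ forall x, tetra T x -> `|p l x| <= M * bary T l x.
  by move=> l; have [M] := mono_span_face (p_span l) (@p_face l); exists M.
have [L L0 DL] := mono_span_bounded D_span.
exists (\sum_l M l + L) => [|x s s0 nTx].
  by rewrite addr_ge0 // sumr_ge0 // => l _; case: (MP l).
apply: le_trans (ler_normB _ _) _; apply: lerD; last first.
  have [Tx1|nTx1] := pselect (tetra T (x + s *: e 1)).
    by rewrite patchT ?inE //; exact: DL.
  by rewrite patchN ?notin_setE // normr0.
apply: le_trans (ler_norm_sum _ _ _) _; apply: ler_sum => l _.
rewrite /g [X in _ - X]patchN ?notin_setE // subr0.
have [Tl|nTl] := pselect (tetra T (x + s *: e l)); last first.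
  by rewrite patchN ?notin_setE // mul0r normr0; case: (MP l).
rewrite patchT ?inE // normrM normfV (gtr0_norm s0) ler_pdivrMr //.
apply: le_trans ((MP l).2 _ Tl) _; apply: ler_wpM2l; first by case: (MP l).
have /existsP[i xi] : [exists i, bary T i x < 0].
  apply: contra_notT nTx; rewrite negb_exists => /forallP x0; apply/tetraE => i.
  by rewrite leNgt.
move/tetraE : Tl => /(_ i); rewrite !bary_step.
rewrite eqxx; have [il|_] := eqVneq i l.
  by rewrite -il; case: (i == 0) => /= *; lra.
by case: (i == 0); case: (l == 0) => /= *; lra.
Qed.

Lemma quotient_defect_bounded : exists2 C, 0 <= C &
  forall x s, 0 < s <= 1 -> `|K s x| <= C.
Proof.
have [C1 C10 K1] := quotient_defect_inner; have [C2 C20 K2] := quotient_defect_outer.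
have [C3 C30 K3] := mono_span_face (p_span 0) (@p_face 0).
exists (C1 + C2 + C3) => [|x s /andP[s0 s1]]; first by rewrite !addr_ge0.
have [Tx|nTx] := pselect (tetra T x); last by apply: le_trans (K2 x s s0 nTx) _; lra.
have [sx|xs] := leP s (bary T 0 x).
  apply: le_trans (K1 x s s0 Tx sx) _; have := ler_wpM2l C10 s1; lra.
(* In the layer [p 0 x] is at most a multiple of [bary T 0 x], which is less than [s]. *)
rewrite quotient_defect_layer // normrM normfV (gtr0_norm s0) ler_pdivrMr //.
apply: le_trans (K3 x Tx) _; have /tetraE/(_ 0) x0 := Tx.
have := ler_wpM2l C30 (ltW xs).
have := mulr_ge0 C10 (ltW s0); have := mulr_ge0 C20 (ltW s0); lra.
Qed.

Lemma quotient_defect_support : exists2 N, 0 < N &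
  forall (t : R * R * R) s, 0 < s <= 1 -> ~ cube 0 N t -> K s (point3 t) = 0.
Proof.
have [N N0 TN] := tetra_coord_bound T.
(* One [N] bounds the tetrahedron; a step with [s <= 1] moves a coordinate by at most [2 * N]. *)
exists (3 * N) => [|t s /andP[s0 s1] nct]; first by rewrite mulr_gt0.
have vN i (k : 'I_3) : `|vertex T i 0 k| <= N.
  by apply: TN; apply/tetraE => l; rewrite bary_vertex ler0n.
have out l : ~ tetra T (point3 t + s *: e l).
  move=> Tl; apply: nct; apply/cube0P => j.
  have -> : point3 t 0 j = (point3 t + s *: e l) 0 j - s * (vertex T l 0 j - vertex T 0 0 j).
    by rewrite !mxE; ring.
  apply: le_trans (ler_normB _ _) _; have := TN _ j Tl.
  have : `|s * (vertex T l 0 j - vertex T 0 0 j)| <= 2 * N.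
    rewrite normrM (gtr0_norm s0); apply: le_trans (ler_piMl _ s1) _ => //.
    by apply: le_trans (ler_normB _ _) _; have := vN l j; have := vN 0 j; lra.
  lra.
have out0 : ~ tetra T (point3 t).
  by move=> Tt; apply: (out 0); rewrite /e subrr scaler0 addr0.
rewrite /K big1 => [|l _]; first by rewrite patchN ?notin_setE ?sub0r ?oppr0.
by rewrite /g !patchN ?notin_setE // subrr mul0r.
Qed.

(** The range of [s] may depend on [x]: below [bary T 0 x] all steps stay inside, on the face
    opposite to 0 the layer formula gives 0, and outside, steps shorter than the size of a negative
    coordinate never reach the tetrahedron. *)
Lemma quotient_defect_cvg x : (fun n => K (n.+1%:R^-1) x) @ \oo --> 0.
Proof.
suff [C [d d0 KC]] : exists C, exists2 d, 0 < d & forall s, 0 < s -> s < d -> `|K s x| <= C * s.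
  apply: norm_cvg0; apply: (@squeeze_cvgr _ _ _ _ (cst 0) (fun n => C * harmonic n)).
  - near=> n; rewrite normr_ge0 /=; apply: KC => //.
    near: n; exact: (cvgr_lt _ (@cvg_harmonic R)).
  - exact: cvg_cst.
  - by rewrite -[X in _ --> X](mulr0 C); apply: cvgMr; exact: cvg_harmonic.
have [Tx|nTx] := pselect (tetra T x).
  have [x0|x0] := eqVneq (bary T 0 x) 0.
    exists 0, 1 => // s s0 _; rewrite mul0r quotient_defect_layer ?x0 //.
    by rewrite p_face ?mul0r ?normr0 //; apply/faceE.
  have [C _ KC] := quotient_defect_inner.
  exists C, (bary T 0 x) => [|s s0 sx]; last by apply: KC => //; exact: ltW.
  by rewrite lt_def x0; have /tetraE := Tx; apply.
have /existsP[i xi] : [exists i, bary T i x < 0].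
  apply: contra_notT nTx; rewrite negb_exists => /forallP x0; apply/tetraE => i.
  by rewrite leNgt.
exists 0, (- bary T i x) => [|s s0 sx]; first by rewrite oppr_gt0.
have out l : ~ tetra T (x + s *: e l).
  move/tetraE/(_ i); rewrite bary_step; case: (i == l); case: (i == 0) => /=; nra.
rewrite mul0r /K big1 => [|l _]; first by rewrite patchN ?notin_setE ?sub0r ?oppr0 ?normr0.
by rewrite /g !patchN ?notin_setE // subrr mul0r.
Unshelve. all: by end_near. Qed.

Local Notation mu := (@lebesgue3 R).
Local Notation R3 := (measurableTypeR R * measurableTypeR R * measurableTypeR R)%type.

(** All terms of [K s] are translation differences, of zero integral, except the shifted [D], which
    is [D] plus one more such difference. The integral thus does not depend on [s]. *)
Lemma integral_quotient_defect s :
  mu.-integrable setT (EFin \o (K s \o @point3 R)) /\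
  \int[mu]_t K s (point3 t) = - \int[mu]_t (D \_ (tetra T)) (point3 t).
Proof.
pose Z (F : R3 -> R) := mu.-integrable setT (EFin \o F) /\ \int[mu]_t F t = 0.
have Z0 : Z (cst 0) by split; [exact: integrable0|by rewrite Rintegral_cst // mul0r].
have ZD F G : Z F -> Z G -> Z (F \+ G).
  move=> [iF F0] [iG G0]; split; last by rewrite RintegralD // F0 G0 addr0.
  exact: (integrableD measurableT iF iG).
have ZZ c F : Z F -> Z (fun t => F t * c).
  move=> [iF F0]; split; last by rewrite RintegralZr // F0 mul0r.
  rewrite (_ : _ \o _ = fun t => (c%:E * (EFin \o F) t)%E); first exact: integrableZl.
  by apply/funext => t; rewrite /= -EFinM mulrC.
have ZS w (F : V -> R) : mu.-integrable setT (EFin \o (F \o @point3 R)) ->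
    Z (fun t => F (point3 t + w) - F (point3 t)).
  move=> iF; have iFw : mu.-integrable setT (EFin \o (fun t => F (point3 t + w))).
    rewrite (_ : _ \o _ = (EFin \o (F \o @point3 R)) \o shift3 (coords w)).
      exact: integrable_shift3.
    by apply/funext => t /=; rewrite point3_shift.
  split; first exact: (integrableB measurableT iFw iF).
  rewrite RintegralB //; apply/eqP; rewrite subr_eq0; apply/eqP.
  rewrite /Rintegral; congr fine; rewrite -[RHS](integral_shift3 (coords w) iF).
  by apply: eq_integral => t _ /=; rewrite point3_shift.
pose G (t : R3) := \sum_l (g l (point3 t + s *: e l) - g l (point3 t)) / s
    + ((D \_ (tetra T)) (point3 t + s *: e 1) - (D \_ (tetra T)) (point3 t)) * (-1).
have iD := integrable_restrict_tetra D_span.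
have [iG G0] : Z G.
  apply: (ZD); last by apply: (ZZ); exact: ZS.
  rewrite (_ : (fun _ => _) =
      \sum_l (fun t => (g l (point3 t + s *: e l) - g l (point3 t)) / s)).
    elim/big_ind : _ => [|F1 F2|l _]; [exact: Z0|exact: ZD|].
    by apply: ZZ; apply: ZS; exact: integrable_restrict_tetra (p_span l).
  by apply/funext => t; rewrite fct_sumE.
have KE : K s \o @point3 R = G \- ((D \_ (tetra T)) \o @point3 R).
  by apply/funext => t; rewrite /K /G /=; ring.
split; first by rewrite KE; exact: (integrableB measurableT iG iD).
by rewrite [LHS](_ : _ = \int[mu]_t (K s \o @point3 R) t) // KE RintegralB // G0 sub0r.
Qed.

(** The integrals of the defects are constant in [s], yet tend to 0 by dominated convergence with a
    constant on a cube as bound. *)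
Lemma integral_edge_divergence : \int[mu]_(t in @point3 R @^-1` tetra T) D (point3 t) = 0.
Proof.
rewrite Rintegral_mkcond -/(D \o @point3 R) -restrict_tetra_point3.
have [C C0 KC] := quotient_defect_bounded; have [N N0 KN] := quotient_defect_support.
have s01 n : 0 < (n.+1%:R^-1 : R) <= 1 by rewrite invr_gt0 ltr0Sn invf_le1 ?ler1n ?ltr0Sn.
pose f_ n := EFin \o (K n.+1%:R^-1 \o @point3 R).
have iC : mu.-integrable setT (EFin \o ((cst C) \_ (cube 0 N))).
  apply: (@bounded_support_integrable _ 0 N C) => //.
  - by apply/(measurable_restrictT _ (measurable_cube 0 N)); exact: measurable_cst.
  - move=> t; have [ct|nct] := pselect (cube 0 N t).
      by rewrite patchT ?inE // ger0_norm.
    by rewrite patchN ?notin_setE // normr0.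
  - by move=> t nct; rewrite patchN ?notin_setE.
have [_ _ lim0] : [/\ mu.-integrable setT (cst 0%E),
    [sequence \int[mu]_t `|f_ n t - cst 0%E t|]_n @ \oo --> 0 &
    [sequence \int[mu]_t f_ n t]_n @ \oo --> \int[mu]_t (cst 0%E) t]%E.
  apply: (dominated_convergence _ _ _ _ iC) => //.
  - by move=> n; have [/integrableP[]] := integral_quotient_defect n.+1%:R^-1.
  - apply: aeW => t _; apply/cvg_EFin; first by apply: nearW.
    exact: quotient_defect_cvg.
  - apply: aeW => t n _; rewrite /f_ /= lee_fin.
    have [ct|nct] := pselect (cube 0 N t); first by rewrite patchT ?inE //; exact: KC.
    by rewrite patchN ?notin_setE // KN ?normr0.
have fE n : (\int[mu]_t f_ n t = (- \int[mu]_t (D \_ (tetra T)) (point3 t))%:E)%E.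
  have [iK <-] := integral_quotient_defect n.+1%:R^-1.
  by rewrite /Rintegral fineK //; exact: integrable_fin_num.
move: lim0; rewrite integral_cst //= mul0e => lim0.
have := cvg_lim (@ereal_hausdorff R) lim0.
under eq_fun do rewrite fE.
rewrite (lim_cst (@ereal_hausdorff R)) => /(_ _) [/eqP]; rewrite oppr_eq0 => /eqP; exact.
Qed.

End DifferenceQuotient.

(** * Outward normals as gradients of barycentric coordinates *)

Section Normals.
Variables (R : realType) (T : tetrahedron R).
Local Notation V := 'rV[R]_3.
Implicit Types (x w : V) (i j l : 'I_4).

Lemma dbary_dot l w : dbary T l w = dot w (\row_j dbary T l (delta_mx 0 j)).
Proof.
rewrite {1}[w]row_sum_delta linear_sum; apply: eq_bigr => j _.
by rewrite linearZ /= mxE.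
Qed.

(** The boundary condition quantifies over outward normals, so using it takes an actual one: minus
    the normalised gradient of [bary T l], which is constant on the face and increases towards
    vertex [l]. *)
Lemma outward_normal_exists l : exists n c,
  [/\ outward_unit_normal T l n, 0 < c & forall w, dot w n = - c * dbary T l w].
Proof.
pose gr : V := \row_j dbary T l (delta_mx 0 j).
have gr0 : 0 < dot gr gr.
  rewrite lt_def; apply/andP; split; last first.
    by apply: sumr_ge0 => j _; rewrite -expr2 sqr_ge0.
  apply/negP => /eqP /psumr_eq0P g0.
  have gr0 : gr = 0.
    apply/rowP => j; rewrite [RHS]mxE; apply/eqP; rewrite -sqrf_eq0 expr2; apply/eqP.
    by apply: g0 => // k _; rewrite -expr2 sqr_ge0.
  (* The gradient is nonzero because it pairs to 1 with an edge ending at vertex [l]. *)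
  have := dbary_edge T l l (lift l ord0); rewrite dbary_dot -/gr gr0.
  rewrite eqxx (negPf (neq_lift _ _)) /dot big1 => [|j _]; last first.
    by rewrite [X in _ * X]mxE mulr0.
  by rewrite /= subr0 => /eqP; rewrite eq_sym oner_eq0.
have c0 : 0 < (Num.sqrt (dot gr gr))^-1 by rewrite invr_gt0 sqrtr_gt0.
exists (- (Num.sqrt (dot gr gr))^-1 *: gr), (Num.sqrt (dot gr gr))^-1.
have dotZ w c : dot w (c *: gr) = c * dbary T l w.
  rewrite dbary_dot -/gr /dot mulr_sumr; apply: eq_bigr => j _.
  by rewrite mxE mulrCA.
have dotC u w : dot u w = dot w u by apply: eq_bigr => j _; rewrite mulrC.
split=> //; split.
- rewrite dotZ dbary_dot -/gr dotC dotZ dbary_dot -/gr mulrA mulrNN -expr2 exprVn.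
  by rewrite sqr_sqrtr ?mulVf ?gt_eqF // ltW.
- move=> j m jl ml; rewrite dotC dotZ dbary_edge.
  by rewrite ![l == _]eq_sym (negPf jl) (negPf ml) subrr mulr0.
- move=> j jl; rewrite dotC dotZ dbary_edge eqxx [l == _]eq_sym (negPf jl) /= subr0 mulr1.
  by rewrite oppr_lt0.
Qed.

End Normals.

(** * The divergence in edge directions and its integral *)

Section Divergence.
Variables (R : realType) (T : tetrahedron R).
Local Notation V := 'rV[R]_3.
Implicit Types (x w : V) (u v : V -> V).

Lemma derive_sum_direction Q (f : V -> R) (I : Type) (r : seq I)
    (c : I -> R) (w : I -> V) x :
  mono_span T Q f ->
  'D_(\sum_(i <- r) c i *: w i) f x = \sum_(i <- r) c i * 'D_(w i) f x.
Proof.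
move=> Qf; have [_ _ lin] := @derive_mono_span _ T Q setT f (fun _ _ _ _ => Logic.I) Qf.
elim: r => [|a r IH]; last by rewrite !big_cons lin IH.
by rewrite !big_nil; have := lin x 1 0 0; rewrite scaler0 addr0; lra.
Qed.

Lemma derive_sum_scale Q (n : nat) (c : 'I_n -> R) (f : 'I_n -> V -> R) x w :
  (forall j, mono_span T Q (f j)) ->
  'D_w (fun y => \sum_j c j * f j y) x = \sum_j c j * 'D_w (f j) x.
Proof.
move=> Qf; have df j : is_derive x w (c j \*: f j) (c j *: 'D_w (f j) x).
  have [df _ _] := @derive_mono_span _ T Q setT (f j) (fun _ _ _ _ => Logic.I) (Qf j).
  by apply: is_deriveZ; exact: derivableP.
have := is_derive_sum df.
rewrite (_ : \sum_(i < n) c i \*: f i = fun y => \sum_j c j * f j y).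
  by move=> h; exact: (@derive_val _ _ _ _ _ _ _ h).
by apply/funext => y; rewrite fct_sumE.
Qed.

(** The divergence is the trace of the derivative of [v], and the edges from vertex 0 with the forms
    [dbary T l] resolve the identity: the forms sum to zero, so vertex 0 may be subtracted from
    every vertex. *)
Lemma divergence_edges Q v x : (forall j, mono_span T Q (fun y => v y 0 j)) ->
  divergence v x = \sum_l 'D_(vertex T l - vertex T 0) (fun y => dbary T l (v y)) x.
Proof.
move=> Qv.
have dE l w : 'D_w (fun y => dbary T l (v y)) x =
    \sum_j dbary T l (delta_mx 0 j) * 'D_w (fun y => v y 0 j) x.
  rewrite -(derive_sum_scale _ _ _ Qv); congr ('D_w _ x); apply/funext => y.
  by rewrite dbary_dot; apply: eq_bigr => j _; rewrite mxE mulrC.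
under [RHS]eq_bigr do rewrite dE; rewrite exchange_big /=; apply: eq_bigr => j _.
rewrite -(derive_sum_direction _ _ _ _ (Qv j)); congr ('D_ _ _ _).
under eq_bigr do rewrite scalerBr; rewrite sumrB sum_dbary_vertex -scaler_suml.
by rewrite sum_dbary scale0r subr0.
Qed.

Lemma divergence_linear Q (c : R) u v :
  (forall j, mono_span T Q (fun y => u y 0 j)) ->
  (forall j, mono_span T Q (fun y => v y 0 j)) ->
  divergence (fun x => c *: u x + v x) =
    fun x => c * divergence u x + divergence v x.
Proof.
move=> Qu Qv; apply/funext => x; rewrite /divergence.
rewrite mulr_sumr -big_split; apply: eq_bigr => j _ /=.
have d (w : V -> V) : (forall j, mono_span T Q (fun y => w y 0 j)) ->
    is_derive x (delta_mx 0 j) (fun y => w y 0 j) ('D_(delta_mx 0 j) (fun y => w y 0 j) x).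
  move=> Qw; have [dw _ _] := @derive_mono_span _ T Q setT _ (fun _ _ _ _ => Logic.I) (Qw j).
  exact: derivableP.
have h := is_deriveD (is_deriveZ c (d u Qu)) (d v Qv).
rewrite -[RHS](@derive_val _ _ _ _ _ _ _ h); congr ('D_ _ _ _).
by apply/funext => y; rewrite !mxE.
Qed.

Lemma divergence_mono_span (Q Q' : set multi_index) v :
  (forall a i, Q a -> (0 < a i)%N -> Q' (mi_dec a i)) ->
  (forall j, mono_span T Q (fun y => v y 0 j)) -> mono_span T Q' (divergence v).
Proof.
move=> QQ' Qv.
have -> : divergence v = \sum_j (fun x => 'D_(delta_mx 0 j) (fun y => v y 0 j) x).
  by apply/funext => x; rewrite fct_sumE.
apply lin_span_sum => j _.
by have [_ Dv _] := @derive_mono_span _ T Q Q' _ QQ' (Qv j); exact: Dv.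
Qed.

(* Writing [v] through its coordinates [dbary T l (v x)] along the edges from vertex
   0, the boundary condition says that each of them vanishes on a face. *)
Lemma integral_divergence Q v : (forall j, mono_span T Q (fun y => v y 0 j)) ->
  (forall i x n, face T i x -> outward_unit_normal T i n -> dot (v x) n = 0) ->
  \int[@lebesgue3 R]_(t in @point3 R @^-1` tetra T) divergence v (point3 t) = 0.
Proof.
move=> Qv vn; pose p l x := dbary T l (v x).
have p_span l : mono_span T setT (p l).
  have -> : p l = \sum_j dbary T l (delta_mx 0 j) *: (fun x => v x 0 j).
    apply/funext => x; rewrite fct_sumE /p dbary_dot; apply: eq_bigr => j _.
    by rewrite mxE mulrC.
  apply lin_span_sum => j _; apply: lin_spanZ; apply: lin_spanS (Qv j).
  by move=> _ [a _ <-]; exists a.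
have p_face l x : face T l x -> p l x = 0.
  move=> Fx; have [n [c [ln c0 nE]]] := outward_normal_exists T l.
  have /eqP := vn l x n Fx ln; rewrite nE mulf_eq0 oppr_eq0 gt_eqF //=; exact: eqP.
have sum_p x : \sum_l p l x = 0 by exact: sum_dbary.
rewrite -[RHS](integral_edge_divergence p_span p_face sum_p).
by apply: eq_Rintegral => t _; rewrite (divergence_edges _ Qv).
Qed.

End Divergence.

(** * Divergences of bubble fields *)

Section BubbleDivergence.
Variables (R : realType) (T : tetrahedron R).
Local Notation V := 'rV[R]_3.
Implicit Types (x w : V) (u v : V -> V) (a b : multi_index) (r : smoothness).
Local Notation mu := (@lebesgue3 R).
Local Notation domain := (@point3 R @^-1` tetra T).

Lemma bubble_div_span k r v j : bubble_div T k r v ->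
  mono_span T (admissible k r) (fun x => v x 0 j).
Proof. by case=> + _; apply. Qed.

Lemma bubble_div0 k r : bubble_div T k r (fun=> 0).
Proof.
split=> [j|i x n _ _]; last by rewrite /dot big1 // => j _; rewrite mxE mul0r.
rewrite (_ : (fun _ => _) = 0); first exact: lin_span0.
by apply/funext => x; rewrite mxE.
Qed.

Lemma divergence0 : divergence (fun=> 0 : V) = 0 :> (V -> R).
Proof.
apply/funext => x; rewrite /divergence big1 // => m _.
by rewrite (_ : (fun _ => _) = cst 0) ?derive_cst //; apply/funext => y; rewrite mxE.
Qed.

Lemma bubble_div_linear k r (c : R) u v : bubble_div T k r u -> bubble_div T k r v ->
  bubble_div T k r (fun x => c *: u x + v x).
Proof.
move=> [Bu un] [Bv vn]; split=> [j|i x n Fx ln].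
  have := lin_spanP c (Bu j) (Bv j); congr (lin_span _ _).
  by apply/funext => x; rewrite !mxE.
transitivity (c * dot (u x) n + dot (v x) n); last by rewrite (un i) // (vn i) // mulr0 addr0.
rewrite /dot mulr_sumr -big_split; apply: eq_bigr => j _ /=.
by rewrite !mxE mulrDl mulrA.
Qed.

Definition edge_field (a : multi_index) (i j : 'I_4) : V -> V :=
  fun x => bary_monomial T a x *: (vertex T i - vertex T j).

(** On the faces opposite to [i] and [j] the monomial vanishes; the remaining faces contain the
    edge. *)
Lemma edge_field_bubble_div k r a (i j : 'I_4) : admissible k r a ->
  (0 < a i)%N -> (0 < a j)%N -> bubble_div T k r (edge_field a i j).
Proof.
move=> ra ai aj; split=> [m|l x n /faceE[_ xl] [_ ln _]].
  rewrite (_ : (fun _ => _) = (vertex T i - vertex T j) 0 m *: bary_monomial T a).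
    by apply: lin_spanZ; apply: lin_span_base; exists a.
  by apply/funext => x; rewrite mxE [RHS]mulrC.
have mono0 : (0 < a l)%N -> bary_monomial T a x = 0.
  by move=> al; rewrite /bary_monomial (bigD1 l) //= xl expr0n gtn_eqF // mul0r.
have -> : dot (edge_field a i j x) n = bary_monomial T a x * dot n (vertex T i - vertex T j).
  by rewrite /dot mulr_sumr; apply: eq_bigr => m _; rewrite [edge_field _ _ _ _ _ _]mxE; ring.
have [il|il] := eqVneq i l; first by rewrite mono0 ?mul0r // -il.
have [jl|jl] := eqVneq j l; first by rewrite mono0 ?mul0r // -jl.
by rewrite ln ?mulr0.
Qed.

(** For a constant vector [t] the divergence of [f t] is the derivative of [f] along [t], and along
    this edge only the coordinates [i] and [j] vary, at rates 1 and -1. *)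
Lemma divergence_edge_field a (i j : 'I_4) :
  divergence (edge_field a i j) = fun x =>
    (a i)%:R * bary_monomial T (mi_dec a i) x - (a j)%:R * bary_monomial T (mi_dec a j) x.
Proof.
have Sa : mono_span T setT (bary_monomial T a) by apply: lin_span_base; exists a.
apply/funext => x; rewrite /divergence /edge_field; set t := _ - vertex T j.
transitivity ('D_t (bary_monomial T a) x).
  rewrite [in RHS](row_sum_delta t) (derive_sum_direction _ _ _ _ Sa).
  apply: eq_bigr => m _.
  have := derive_sum_scale (fun _ : 'I_1 => t 0 m) x (delta_mx 0 m) (fun _ => Sa).
  rewrite big_ord1 => <-; congr ('D_ _ _ _); apply/funext => y.
  by rewrite big_ord1 mxE mulrC.
rewrite (@derive_val _ _ _ _ _ _ _ (is_derive_bary_monomial T a x t)).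
pose X l := (a l)%:R * bary_monomial T (mi_dec a l) x.
have sumX m : \sum_l (l == m)%:R * X l = X m.
  by rewrite (bigD1 m) //= eqxx mul1r big1 ?addr0 // => l /negPf ->; rewrite mul0r.
rewrite -[RHS]/(X i - X j) -!sumX -sumrB; apply: eq_bigr => l _.
by rewrite dbary_edge -mulrA -mulrBl.
Qed.

Definition mi_fact (a : multi_index) : R := \prod_i (a i)`!%:R.

Lemma mi_fact_gt0 a : 0 < mi_fact a.
Proof. by apply: prodr_gt0 => i _; rewrite ltr0n fact_gt0. Qed.

Lemma mi_fact_dec a (i : 'I_4) : (0 < a i)%N -> mi_fact a = (a i)%:R * mi_fact (mi_dec a i).
Proof.
move=> ai; rewrite /mi_fact (bigD1 i) //= [in RHS](bigD1 i) //= ffunE eqxx subn1 mulrA.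
congr (_ * _); first by rewrite -natrM -{2}(prednK ai) -factS prednK.
by apply: eq_bigr => l /negPf li; rewrite ffunE li subn0.
Qed.

Definition divided_monomial (a : multi_index) : V -> R := (mi_fact a)^-1 *: bary_monomial T a.

(* With the normalisation [lambda^b / b!], all weights become 1. *)
Lemma divided_monomial_dec k r a (i j : 'I_4) : admissible k r a ->
  (0 < a i)%N -> (0 < a j)%N ->
  exists2 v, bubble_div T k r v &
    divergence v = divided_monomial (mi_dec a i) - divided_monomial (mi_dec a j).
Proof.
move=> ra ai aj; have Bv := edge_field_bubble_div ra ai aj.
exists (fun x => (mi_fact a)^-1 *: edge_field a i j x + 0).
  by apply: bubble_div_linear => //; exact: bubble_div0.
rewrite (divergence_linear _ (fun m => bubble_div_span m Bv)
  (fun m => bubble_div_span m (bubble_div0 k r))).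
apply/funext => x; rewrite divergence0 addr0 divergence_edge_field.
rewrite -[RHS]/((mi_fact (mi_dec a i))^-1 * bary_monomial T (mi_dec a i) x -
  (mi_fact (mi_dec a j))^-1 * bary_monomial T (mi_dec a j) x).
have coef l : (0 < a l)%N -> (mi_fact a)^-1 * ((a l)%:R * bary_monomial T (mi_dec a l) x) =
    (mi_fact (mi_dec a l))^-1 * bary_monomial T (mi_dec a l) x.
  move=> al; rewrite (mi_fact_dec al) invfM mulrA; congr (_ * _).
  by rewrite mulrAC mulVf ?mul1r // pnatr_eq0 -lt0n.
by rewrite mulrBr !coef.
Qed.

Definition div_image (k : int) (r : smoothness) : set (V -> R) :=
  [set divergence v | v in bubble_div T k r].

Lemma div_image0 k r : div_image k r 0.
Proof.
by exists (fun=> 0); [exact: bubble_div0|exact: divergence0].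
Qed.

Lemma div_image_linear k r (c : R) (f g : V -> R) :
  div_image k r f -> div_image k r g -> div_image k r (c *: f + g).
Proof.
move=> [u Bu <-] [v Bv <-]; exists (fun x => c *: u x + v x).
  exact: bubble_div_linear.
by rewrite (divergence_linear c (fun m => bubble_div_span m Bu)
  (fun m => bubble_div_span m Bv)).
Qed.

(** Each mass drops by at most one, and the cut-off of [ominus1] at -1 is met because masses are
    natural numbers. *)
Lemma admissible_dec k r a (i : 'I_4) : admissible k r a -> (0 < a i)%N ->
  admissible (k - 1) (sm_ominus1 r) (mi_dec a i).
Proof.
case: r => rv re rf /admissibleP[/= ak a1 a2 a3] ai; apply/admissibleP.
rewrite /sm_ominus1 /ominus1 /=; split=> [|S /a1|S /a2|S /a3].
- by move: ak; rewrite (mass_dec _ ai) finset.in_setT; lia.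
- by rewrite (mass_dec _ ai); case: (i \in S); lia.
- by rewrite (mass_dec _ ai); case: (i \in S); lia.
- by rewrite (mass_dec _ ai); case: (i \in S); lia.
Qed.

Lemma div_image_bubble k r (f : V -> R) : div_image k r f -> bubble T (k - 1) (sm_ominus1 r) f.
Proof.
move=> [v Bv <-]; apply: divergence_mono_span (fun m => bubble_div_span m Bv).
exact: admissible_dec.
Qed.

Lemma integrable_tetra Q (f : V -> R) : mono_span T Q f ->
  mu.-integrable domain (EFin \o (f \o @point3 R)).
Proof.
move=> Qf; apply/(@integrable_mkcond _ _ R mu domain _ (measurable_tetra T)).
have := integrable_restrict_tetra Qf; congr (integrable _ _ _).
rewrite restrict_tetra_point3; apply/funext => t /=.
by rewrite /patch; case: ifP.
Qed.

Lemma mono_span_L2 Q (f : V -> R) : mono_span T Q f ->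
  (f \o @point3 R) \_ domain \in Lfun mu 2%:E.
Proof.
move=> Qf; rewrite -restrict_tetra_point3; set F := _ \o _.
have mF : measurable_fun setT F := measurable_restrict_tetra Qf.
have [N N0 TN] := tetra_coord_bound T; have [M M0 fM] := mono_span_bounded Qf.
have F0 t : ~ tetra T (point3 t) -> F t = 0 by move=> nTt; rewrite /F /= patchN ?notin_setE.
have FM t : `|F t| <= M.
  have [Tt|nTt] := pselect (tetra T (point3 t)); last by rewrite F0 // normr0.
  by rewrite /F /= patchT ?inE //; exact: fM.
apply/andP; split; rewrite inE //= /finite_norm unlock; apply: poweR_lty.
have : mu.-integrable setT (EFin \o (fun t => F t ^+ 2)).
  apply: (@bounded_support_integrable _ 0 N (M ^+ 2)) => //.
  - exact: measurable_funX.
  - by move=> t; rewrite normrX lerXn2r ?nnegrE.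
  - move=> t nct; rewrite F0 ?expr0n // => Tt; apply: nct.
    by apply/cube0P => j; exact: TN.
move=> /integrableP[_]; congr (_ < _)%E; apply: eq_integral => t _ /=.
by rewrite powR_mulrn // normrX.
Qed.

Lemma integral_bary_monomial_gt0 a :
  0 < \int[mu]_(t in domain) bary_monomial T a (point3 t).
Proof.
pose c : V := \sum_i (4^-1 : R) *: vertex T i.
have baryc i : bary T i c = 4^-1.
  by rewrite (@bary_unique _ T (fun=> 4^-1)) // !big_ord_recl big_ord0; lra.
(* On the cube of radius [1 / (8 * M)] about the barycentre each barycentric coordinate differs from
   1/4 by at most 1/8, so the monomial is bounded below there. *)
pose M := 1 + \sum_i \sum_j `|dbary T i (delta_mx 0 j)|.
have M1 : 1 <= M by rewrite lerDl sumr_ge0 // => i _; rewrite sumr_ge0.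
have M0 : 0 < M by rewrite (lt_le_trans _ M1).
pose rho := (8 * M)^-1.
have rho0 : 0 < rho by rewrite invr_gt0 mulr_gt0.
have point3c : point3 (coords c) = c.
  by apply/rowP => -[[|[|[|//]]] j3]; rewrite !mxE; congr (c _ _); apply/val_inj.
have low t i : cube (coords c) rho t -> 8^-1 <= bary T i (point3 t).
  move=> /cubeP[t0 t1 t2].
  have -> : point3 t = c + (point3 t - c) by rewrite addrC subrK.
  rewrite baryD baryc; set w := _ - c.
  have wr (j : 'I_3) : `|w 0 j| <= rho.
    rewrite /w -point3c; case: j => [[|[|[|//]]] j3]; rewrite !mxE //=.
  suff : `|dbary T i w| <= 8^-1 by rewrite ler_norml => /andP[+ _]; lra.
  rewrite {1}[w]row_sum_delta linear_sum; apply: le_trans (ler_norm_sum _ _ _) _.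
  apply: (@le_trans _ _ (\sum_j rho * `|dbary T i (delta_mx 0 j)|)).
    by apply: ler_sum => j _; rewrite linearZ /= normrM ler_wpM2r.
  rewrite -mulr_sumr (_ : 8^-1 = rho * M); last by rewrite /rho invfM mulfVK ?gt_eqF.
  apply: ler_wpM2l; first exact: ltW.
  rewrite /M (bigD1 i) //= addrCA lerDl addr_ge0 // sumr_ge0 // => l _.
  by rewrite sumr_ge0.
pose d : R := (8^-1) ^+ (\sum_i a i)%N.
have lowm t : cube (coords c) rho t -> tetra T (point3 t) /\ d <= bary_monomial T a (point3 t).
  move=> ct; split.
    by apply/tetraE => i; apply: le_trans (low t i ct); rewrite invr_ge0.
  rewrite /d -prodrXr; apply: ler_prod => i _; rewrite exprn_ge0 ?invr_ge0 //=.
  by rewrite lerXn2r ?nnegrE ?low ?invr_ge0 // (le_trans _ (low t i ct)) ?invr_ge0.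
have Sa : mono_span T setT (bary_monomial T a) by apply: lin_span_base; exists a.
rewrite Rintegral_mkcond -/(bary_monomial T a \o @point3 R) -restrict_tetra_point3.
apply: (@lt_le_trans _ _ (\int[mu]_t ((cst d) \_ (cube (coords c) rho)) t)).
  rewrite -Rintegral_mkcond Rintegral_cst; last exact: measurable_cube.
  rewrite (_ : fine _ = (2 * rho) ^+ 3); last first.
    by rewrite -[RHS]/(fine ((2 * rho) ^+ 3)%:E); congr fine; exact: lebesgue3_cube.
  by rewrite mulr_gt0 ?exprn_gt0 ?invr_gt0 // mulr_gt0.
apply: le_Rintegral => //.
- apply: (@bounded_support_integrable _ (coords c) rho d) => //.
  + by apply/(measurable_restrictT _ (measurable_cube _ _)); exact: measurable_cst.
  + move=> t; have d0 : 0 <= d by rewrite exprn_ge0 ?invr_ge0.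
    have [ct|nct] := pselect (cube (coords c) rho t).
      by rewrite patchT ?inE // ger0_norm.
    by rewrite patchN ?notin_setE // normr0.
  + by move=> t nct; rewrite patchN ?notin_setE.
- exact: integrable_restrict_tetra Sa.
- move=> t _; have [ct|nct] := pselect (cube (coords c) rho t).
    by have [Tt dt] := lowm t ct; rewrite /= !patchT ?inE.
  rewrite patchN ?notin_setE //=; have [Tt|nTt] := pselect (tetra T (point3 t)).
    rewrite patchT ?inE //; apply: prodr_ge0 => i _.
    by rewrite exprn_ge0 //; move/tetraE : Tt.
  by rewrite patchN ?notin_setE.
Qed.

Lemma bary_monomialE a : bary_monomial T a = mi_fact a *: divided_monomial a.
Proof. by rewrite /divided_monomial scalerA mulfV ?scale1r // gt_eqF // mi_fact_gt0. Qed.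

(** Modulo the image all divided monomials agree, so the quotient is spanned by the class of the one
    at [b0]. *)
Lemma bubble_mod_div_image k r b0 (q : V -> R) :
  (forall b, admissible (k - 1) (sm_ominus1 r) b ->
     div_image k r (divided_monomial b - divided_monomial b0)) ->
  bubble T (k - 1) (sm_ominus1 r) q ->
  exists c : R, div_image k r (q - c *: divided_monomial b0).
Proof.
move=> conn; elim/lin_span_ind => [|c u v [b rb <-] [d dv]].
  by exists 0; rewrite scale0r subr0; exact: div_image0.
exists (c * mi_fact b + d).
have -> : c *: bary_monomial T b + v - (c * mi_fact b + d) *: divided_monomial b0 =
    (c * mi_fact b) *: (divided_monomial b - divided_monomial b0) + (v - d *: divided_monomial b0).
  rewrite bary_monomialE scalerA scalerBr scalerDl opprD !addrA; congr (_ - _).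
  by rewrite addrAC.
by apply: div_image_linear => //; exact: conn.
Qed.

Lemma integral_div_image k r (f : V -> R) : div_image k r f ->
  \int[mu]_(t in domain) f (point3 t) = 0.
Proof.
move=> [v Bv <-]; apply: integral_divergence (fun m => bubble_div_span m Bv) _.
by case: Bv.
Qed.

Lemma div_imageP k r b0 (q : V -> R) :
  (forall b, admissible (k - 1) (sm_ominus1 r) b ->
     div_image k r (divided_monomial b - divided_monomial b0)) ->
  bubble T (k - 1) (sm_ominus1 r) q -> \int[mu]_(t in domain) q (point3 t) = 0 ->
  div_image k r q.
Proof.
move=> conn Bq q0; have [c dq] := bubble_mod_div_image conn Bq.
suff c0 : c = 0 by move: dq; rewrite c0 scale0r subr0.
have := integral_div_image dq.
have Sm : mono_span T setT (bary_monomial T b0) by apply: lin_span_base; exists b0.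
rewrite (_ : (fun t => _) =
    fun t => q (point3 t) - (c / mi_fact b0) * bary_monomial T b0 (point3 t)).
  rewrite RintegralB //; [|exact: measurable_tetra|exact: integrable_tetra Bq|]; last first.
    exact: integrable_tetra (lin_spanZ (c / mi_fact b0) Sm).
  rewrite q0 RintegralZl; [|exact: measurable_tetra|exact: integrable_tetra Sm].
  rewrite sub0r => /eqP; rewrite oppr_eq0 mulf_eq0 (gt_eqF (integral_bary_monomial_gt0 b0)) orbF.
  by rewrite mulf_eq0 invr_eq0 (gt_eqF (mi_fact_gt0 b0)) orbF => /eqP.
by apply/funext => t; rewrite -mulrA.
Qed.

End BubbleDivergence.

Unset Implicit Arguments.

Theorem theorem4p5 (R : realType) (T : tetrahedron R) (r2 : smoothness)
    (k : int) (hk : Num.max (2 * sm_v r2 + 1) 1 <= k)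
    (hr : [\/ [/\ 0 <= sm_f r2, 2 * sm_f r2 + 1 <= sm_e r2
                & 2 * sm_e r2 <= sm_v r2],
              [/\ sm_f r2 = -1, 1 <= sm_e r2 & 2 * sm_e r2 <= sm_v r2]
            | [/\ sm_f r2 = -1, sm_e r2 = 0 \/ sm_e r2 = -1
                & 2 * sm_e r2 + 1 <= sm_v r2]])
    (hdim : (1 <= lin_dim (bubble T (k - 1) (sm_ominus1 r2)))%N) :
  [set divergence v | v in bubble_div T k r2] =
  bubble_mean0 T (k - 1) (sm_ominus1 r2).
Proof.
apply/seteqP; split=> [f df|q [Bq [_ q0]]].
  have Bf := div_image_bubble df; split=> //.
  by split; [exact: mono_span_L2 Bf|exact: integral_div_image df].
have [[b0 rb0]|none] := pselect (exists b, admissible (k - 1) (sm_ominus1 r2) b).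
  apply: (div_imageP (b0 := b0)) Bq q0 => b rb.
  (* [E] is congruence of divided monomials modulo the image; the edge fields supply its elementary
     instances. *)
  pose E b b' := div_image T k r2 (divided_monomial T b - divided_monomial T b').
  apply: (admissible_connected (E := E) hk hr) rb rb0.
  - by move=> c; rewrite /E subrr; exact: div_image0.
  - move=> b1 b2 b3 E12 E23.
    have := div_image_linear 1 E12 E23; rewrite scale1r /E.
    by rewrite addrA subrK.
  - by move=> a i j ra ai aj; have [v Bv dv] := divided_monomial_dec T ra ai aj; exists v.
(* With no admissible exponent the span contains only 0. *)
elim/lin_span_ind : Bq q0 => [_|c u v [b rb _]]; first exact: div_image0.
by case: none; exists b.
Qed.
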